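(* Let $G$ be a locally compact group, let $K_1,K_2\in\mathcal{K}(G)$, $\rho_1\in\widehat{(K_1)}_1$ and $\rho_2\in\widehat{(K_2)}_1$, and put $K=K_1\cap K_2$. Then $\rho_1 m_{K_1}$ and $\rho_2 m_{K_2}$ commute in $\mathrm{M}(G)$ (with respect to convolution) if and only if one of the following cases holds: (i) $\rho_1|_K\neq\rho_2|_K$, in which case $(\rho_1 m_{K_1})\ast(\rho_2 m_{K_2})=0$; or (ii) $\rho_1|_K=\rho_2|_K$, $K_1K_2\in\mathcal{K}(G)$, and the function $\rho:K_1K_2\to\mathbb{C}$ given by $\rho(k_1k_2)=\rho_1(k_1)\rho_2(k_2)$ for $k_1\in K_1$ and $k_2\in K_2$ defines a character (i.e. an element of $\widehat{(K_1K_2)}_1$); in which case $(\rho_1 m_{K_1})\ast(\rho_2 m_{K_2})=\rho\, m_{K_1K_2}$. In particular, the idempotent probabilities $m_{K_1}$ and $m_{K_2}$ commute if and only if $K_1K_2\in\mathcal{K}(G)$, and in this case $m_{K_1}\ast m_{K_2}=m_{K_1K_2}$.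
   Context: $\mathrm{M}(G)$ denotes the measure algebra of $G$: the complex (finite, regular) Borel measures on $G$, identified with the dual of $\mathcal{C}_0(G)$, with convolution $\ast$ as product. $\mathcal{K}(G)$ denotes the collection of all compact subgroups of $G$. For $K\in\mathcal{K}(G)$, $m_K$ is the normalised Haar measure on $K$, regarded as an element of $\mathrm{M}(G)$, and $\widehat{K}_1$ is the set of multiplicative characters of $K$, i.e. continuous homomorphisms $K\to\mathbb{T}=\{z\in\mathbb{C}:|z|=1\}$. For $\rho\in\widehat{K}_1$ the measure $\rho m_K\in\mathrm{M}(G)$ is given by $\int_G u\,d(\rho m_K)=\int_K u(k)\rho(k)\,dm_K(k)$ for $u\in\mathcal{C}_0(G)$. $K_1K_2=\{k_1k_2:k_1\in K_1,k_2\in K_2\}$. *)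

(* Defs.v *)
From HB Require Import structures.
From mathcomp Require Import all_boot all_order all_algebra.
From mathcomp Require Import all_classical all_reals all_analysis complex.

Set Implicit Arguments.
Unset Strict Implicit.
Unset Printing Implicit Defensive.

Import Order.TTheory GRing.Theory Num.Theory numFieldNormedType.Exports.

Local Open Scope classical_set_scope.
Local Open Scope complex_scope.
Local Open Scope ring_scope.

(* Locally compact groups are Hausdorff. The base point provided by
   PointedTopological plays no role; measurable types have to be pointed. *)
HB.mixin Record isLocallyCompactGroup G
    of Group G & PointedTopological G := {
  mulg_continuous : continuous (fun p : G * G => (p.1 * p.2)%g : G);
  invg_continuous : continuous (fun x : G => (x^-1)%g : G);
  group_hausdorff : hausdorff_space G;
  group_locally_compact : locally_compact [set: G]
}.

#[short(type="lcGroupType")]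
HB.structure Definition LocallyCompactGroup :=
  {G of isLocallyCompactGroup G & Group G & PointedTopological G}.

Definition borel (G : lcGroupType) := g_sigma_algebraType (@open G).

Section complex_numbers.
Variable R : realType.

Lemma norm_RRe (z : R[i]) : `|z| = (complex.Re `|z|)%:C.
Proof. by rewrite RRe_real ?normr_real. Qed.

Lemma phase_norm (a b : R[i]) :
  exists2 l : R[i], `|l| = 1 & `|a + l * b| = `|a| + `|b|.
Proof.
have [->|a0] := eqVneq a 0.
  by exists 1; rewrite ?normr1 // mul1r add0r normr0 add0r.
have [->|b0] := eqVneq b 0.
  by exists 1; rewrite ?normr1 // mulr0 addr0 normr0 addr0.
exists ((a / `|a|) * (`|b| / b)).
  by rewrite !normrM !normfV !normr_id !divff ?mulr1 // normr_eq0.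
have -> : a + a / `|a| * (`|b| / b) * b = a / `|a| * (`|a| + `|b|).
  by rewrite mulrDr -!mulrA !mulVf ?normr_eq0 // !mulr1.
rewrite !normrM normfV !normr_id divff ?normr_eq0 // mul1r.
by rewrite ger0_norm // addr_ge0.
Qed.

End complex_numbers.

Section C0.
Variables (R : realType) (G : lcGroupType).

(* 0 < e in R[i] means that e is a positive real. *)
Definition vanishes_at_infinity (u : G -> R[i]^o) :=
  forall e : R[i], 0 < e ->
    exists2 K : set G, compact K & forall x, ~ K x -> `|u x| < e.

Definition C0_pred : {pred G -> R[i]^o} :=
  fun u => `[< continuous u /\ vanishes_at_infinity u >].

Lemma C0_submod : submod_closed C0_pred.
Proof.
split.
  apply/asboolP; split; first exact: cst_continuous.
  by move=> e e0; exists set0; [exact: compact0|move=> x _ /=; rewrite normr0].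
move=> a u v /asboolP[cu hu] /asboolP[cv hv].
apply/asboolP; split.
  move=> x; apply: cvgD; last exact: cv.
  by apply: cvgZl_tmp; exact: cu.
move=> e e0.
have a1 : 0 < `|a| + 1 by rewrite ltr_wpDl.
have e1 : 0 < e / 2 by rewrite divr_gt0.
have [A cA hA] := hu _ (divr_gt0 e1 a1).
have [B cB hB] := hv _ e1.
exists (A `|` B); first exact: compactU.
move=> x ABx.
have /hA hAx : ~ A x by move=> Ax; apply: ABx; left.
have /hB hBx : ~ B x by move=> Bx; apply: ABx; right.
rewrite [e]splitr; apply: (le_lt_trans (ler_normD _ _)).
apply: ler_ltD => //; rewrite normrM.
apply: (@le_trans _ _ ((`|a| + 1) * (e / 2 / (`|a| + 1)))).
  by apply: ler_pM => //; [rewrite lerDl|exact: ltW].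
by rewrite mulrC divfK // gt_eqF.
Qed.

HB.instance Definition _ := GRing.isSubmodClosed.Build _ _ C0_pred C0_submod.

Definition C0 := {u : G -> R[i]^o | u \in C0_pred}.
HB.instance Definition _ := SubChoice.on C0.
HB.instance Definition _ := [SubChoice_isSubLmodule of C0 by <:].

Definition C0_fun (u : C0) : G -> R[i] := val u.
Coercion C0_fun : C0 >-> Funclass.

Definition mkC0 (u : G -> R[i]^o)
    (hu : continuous u /\ vanishes_at_infinity u) : C0 :=
  exist _ u (introT (asboolP _) hu).

(* M(G) is the dual of C_0(G): the functionals that are linear and bounded for
   the supremum norm. The value of mu at u is the integral of u against mu. *)
Definition measure_alg_pred : {pred C0 -> R[i]^o} := fun mu =>
  `[< linear mu /\
      exists M : R[i], forall (u : C0) (r : R[i]),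
        (forall x, `|u x| <= r) -> `|mu u| <= M * r >].

Lemma measure_alg_submod : submod_closed measure_alg_pred.
Proof.
split.
  apply/asboolP; split; first by move=> a u v; rewrite /= scaler0 addr0.
  by exists 0 => u r _; rewrite mul0r /= normr0.
move=> a mu nu /asboolP[lmu [M hM]] /asboolP[lnu [N hN]].
apply/asboolP; split.
  move=> b u v; rewrite !fctE lmu lnu !scalerDr !scalerA [b * a]mulrC.
  by rewrite addrACA.
exists (`|a| * M + N) => u r ur; rewrite mulrDl.
apply: (le_trans (ler_normD _ _)); apply: lerD; last exact: hN.
by rewrite normrM -mulrA; apply: ler_wpM2l => //; exact: hM.
Qed.

HB.instance Definition _ :=
  GRing.isSubmodClosed.Build _ _ measure_alg_pred measure_alg_submod.

Definition measure_alg := {mu : C0 -> R[i]^o | mu \in measure_alg_pred}.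
HB.instance Definition _ := SubChoice.on measure_alg.
HB.instance Definition _ := [SubChoice_isSubLmodule of measure_alg by <:].
Definition measure_alg_fun (mu : measure_alg) : C0 -> R[i] := val mu.
Coercion measure_alg_fun : measure_alg >-> Funclass.

Lemma measure_alg_linear (mu : measure_alg) (a : R[i]) (u v : C0) :
  mu (a *: u + v) = a * mu u + mu v.
Proof. by have /asboolP[lmu _] := valP mu; exact: lmu. Qed.

Lemma measure_alg_bounded (mu : measure_alg) :
  exists M : R[i], forall (u : C0) (r : R[i]),
    (forall x, `|u x| <= r) -> `|mu u| <= M * r.
Proof. by have /asboolP[] := valP mu. Qed.

Lemma C0_continuous (u : C0) : continuous (u : G -> R[i]^o).
Proof. by have /asboolP[] := valP u. Qed.

Lemma C0_vanishes (u : C0) : vanishes_at_infinity u.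
Proof. by have /asboolP[] := valP u. Qed.

Lemma C0_near (u : C0) (x : G) (e : R[i]) :
  0 < e -> \forall y \near x, `|u x - u y| < e.
Proof.
by move=> e0; have /cvgr_dist_lt /(_ _ e0) := @C0_continuous u x; exact.
Qed.

Lemma C0_bounded (u : C0) : exists2 r : R[i], 0 < r & forall x, `|u x| <= r.
Proof.
have [K cK hK] := C0_vanishes u ltr01.
have bndK : \forall r \near (+oo : set_system R[i]),
    K `<=` [set x | `|u x| <= r].
  apply: (@compact_near_coveringP G K).1 cK _ _ _ _ _ => x _.
  have ux := C0_near u x ltr01.
  near=> x' r => /=.
  apply: (@le_trans _ _ (`|u x| + 1)); last first.
    by near: r; apply: nbhs_pinfty_ge; rewrite realD ?normr_real.
  rewrite -lerBlDl; apply: (le_trans (lerB_dist _ _)); rewrite distrC ltW //.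
  by near: x'; exact: ux.
near (+oo : set_system R[i]) => r.
have r1 : 1 < r by near: r; exact: nbhs_pinfty_gt.
exists r; first exact: lt_trans r1.
move=> x; have [Kx|/hK ux1] := pselect (K x); last first.
  exact: ltW (lt_trans ux1 r1).
have KP : K `<=` [set x | `|u x| <= r] by near: r.
exact: KP.
Unshelve. all: by end_near.
Qed.

Lemma lmul_continuous (x : G) : continuous (fun y : G => (x * y)%g).
Proof.
move=> y; apply: (@continuous_comp _ _ _ (fun y : G => (x, y))
  (fun p : G * G => (p.1 * p.2)%g)).
  by apply: cvg_pair => //=; exact: cvg_cst.
exact: mulg_continuous.
Qed.

Lemma ltrans_C0 (u : C0) (x : G) :
  continuous (fun y => u (x * y)%g : R[i]^o) /\
  vanishes_at_infinity (fun y => u (x * y)%g).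
Proof.
split.
  move=> y; apply: (@continuous_comp _ _ _ (fun y : G => (x * y)%g)
    (u : G -> R[i]^o)).
    exact: lmul_continuous.
  exact: C0_continuous.
move=> e e0; have [K cK hK] := C0_vanishes u e0.
exists ((fun y => (x^-1 * y)%g) @` K).
  apply: continuous_compact => //; apply: continuous_subspaceT.
  exact: lmul_continuous.
move=> y Ky; apply: hK => Kxy; apply: Ky.
by exists (x * y)%g => //; rewrite mulKg.
Qed.

Definition ltrans (x : G) (u : C0) : C0 := mkC0 (ltrans_C0 u x).

Lemma ltrans_unif (u : C0) (e : R[i]) : 0 < e ->
  \forall w \near (1%g : G), forall z, `|u z - u (w * z)%g| < e.
Proof.
move=> e0; have e20 : 0 < e / 2 by rewrite divr_gt0.
have [K cK hK] := C0_vanishes u e20.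
have nK : \forall w \near (1%g : G),
    K `<=` [set z | `|u z - u (w * z)%g| < e].
  apply: (@compact_near_coveringP G K).1 cK _ _ _ _ _ => x _.
  have ux := C0_near u x e20.
  have uwx : \forall p \near (x, (1%g : G)), `|u x - u (p.2 * p.1)%g| < e / 2.
    have cm : {for (x, 1%g : G), continuous (fun p : G * G => (p.2 * p.1)%g)}.
      apply: (@continuous_comp _ _ _ (fun p : G * G => (p.2, p.1))
        (fun p : G * G => (p.1 * p.2)%g)); last exact: mulg_continuous.
      by apply: cvg_pair => //=; [exact: cvg_snd|exact: cvg_fst].
    have /= := cm [set y | `|u x - u y| < e / 2].
    by rewrite mul1g => /(_ ux).
  have ux' : \forall p \near (x, (1%g : G)), `|u x - u p.1| < e / 2.
    exact: (@cvg_fst G G (nbhs x) (nbhs (1%g : G)) _ _ ux).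
  apply: filterS2 uwx ux' => -[x' w] /= h1 h2.
  rewrite [e]splitr; apply: (le_lt_trans (ler_distD (u x) _ _)).
  by apply: ltrD; first rewrite distrC.
have nKV : \forall w \near (1%g : G),
    K `<=` [set z | `|u z - u (w^-1 * z)%g| < e].
  have := @invg_continuous G 1%g _ ; rewrite /= invg1 => /(_ _ nK); exact.
apply: filterS2 nK nKV => w hw hwV z.
have [Kz|nKz] := pselect (K z); first exact: hw.
have [Kwz|nKwz] := pselect (K (w * z)%g).
  by have /= := hwV _ Kwz; rewrite mulKg distrC.
rewrite [e]splitr; apply: (le_lt_trans (ler_normB _ _)).
by apply: ltrD; exact: hK.
Qed.

Lemma measure_alg0 (mu : measure_alg) : mu 0 = 0.
Proof.
have := measure_alg_linear mu 1 0 0; rewrite scaler0 addr0 mul1r => /eqP.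
by rewrite -subr_eq0 opprD addNKr oppr_eq0 => /eqP.
Qed.

Lemma measure_algZ (mu : measure_alg) (a : R[i]) (u : C0) :
  mu (a *: u) = a * mu u.
Proof. by rewrite -[a *: u]addr0 measure_alg_linear measure_alg0 addr0. Qed.

Lemma measure_alg_bounded_ge0 (mu : measure_alg) :
  exists2 M : R[i], 0 <= M & forall (u : C0) (r : R[i]),
    (forall x, `|u x| <= r) -> `|mu u| <= M * r.
Proof.
have [M hM] := measure_alg_bounded mu; exists `|M| => // u r ur.
have r0 : 0 <= r := le_trans (normr_ge0 _) (ur 1%g).
rewrite -(ger0_norm r0) -normrM ger0_norm; first exact: hM.
exact: le_trans (normr_ge0 _) (hM _ _ ur).
Qed.

Lemma C0_linearE (a : R[i]) (u v : C0) (x : G) :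
  (a *: u + v : C0) x = a * u x + v x.
Proof. by []. Qed.

Lemma C0_scaleE (a : R[i]) (u : C0) (x : G) : (a *: u : C0) x = a * u x.
Proof. by []. Qed.

Lemma C0_ext (u v : C0) : (forall x, u x = v x) -> u = v.
Proof. by move=> uv; apply: val_inj; apply/funext. Qed.

Lemma measure_alg_tight (nu : measure_alg) (e : R[i]) : 0 < e ->
  exists (K : set G) (d : R[i]), [/\ compact K, 0 < d &
    forall v : C0, (forall x, `|v x| <= 1) -> (forall x, K x -> `|v x| <= d) ->
      `|nu v| <= e].
Proof.
move=> e0.
pose S := [set r : R | exists2 u : C0, forall x, `|u x| <= 1
                                     & r = complex.Re `|nu u|].
have [M hM] := measure_alg_bounded nu.
have supS : has_sup S.
  split; first by exists (complex.Re `|nu 0|); exists 0 => // x; rewrite normr0.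
  exists (complex.Re M) => _ [u u1 ->].
  by have := hM u 1 u1; rewrite mulr1 lecE => /andP[].
pose s := sup S.
have nuS (u : C0) : (forall x, `|u x| <= 1) -> `|nu u| <= s%:C.
  move=> u1; rewrite norm_RRe lecR; apply: sup_upper_bound => //.
  by exists u.
have s0 : 0 <= s%:C.
  by apply: le_trans (nuS 0 _) => // x; rewrite normr0.
have nuc (c : R[i]) (u : C0) :
    0 < c -> (forall x, `|u x| <= c) -> `|nu u| <= c * s%:C.
  move=> c0 uc; have /= := nuS (c^-1 *: u).
  rewrite measure_algZ normrM ger0_norm ?invr_ge0 ?(ltW c0)// ler_pdivrMl //.
  apply=> x; rewrite C0_scaleE normrM ger0_norm ?invr_ge0 ?(ltW c0)//.
  by rewrite ler_pdivrMl // mulr1.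
have eE : e = (complex.Re e)%:C by rewrite RRe_real // gtr0_real.
have e20 : 0 < complex.Re e / 2 by rewrite divr_gt0 // -ltcR -eE.
have [_ [u0 u01 ->] hu0] := sup_adherent e20 supS.
have {}hu0 : s%:C < `|nu u0| + e / 2.
  by move: hu0; rewrite ltrBlDr -ltcR rmorphD /= -norm_RRe rmorphM fmorphV /=
    -eE rmorph_nat.
have s10 : 0 < s%:C + 1 by rewrite ltr_wpDl.
pose d := e / 2 / (s%:C + 1).
have d0 : 0 < d by rewrite !divr_gt0.
have [K cK hK] := C0_vanishes u0 d0.
exists K, d; split=> // v v1 vd.
have [l l1 hl] := phase_norm (nu u0) (nu v).
have := nuc (1 + d) (l *: v + u0).
rewrite measure_alg_linear (addrC (l * nu v)) hl.
move=> /(_ (addr_gt0 ltr01 d0)) H.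
have {}H : `|nu u0| + `|nu v| <= (1 + d) * s%:C.
  apply: H => x; rewrite C0_linearE; apply: (le_trans (ler_normD _ _)).
  rewrite normrM l1 mul1r.
  have [Kx|nKx] := pselect (K x); first by rewrite addrC lerD //; exact: vd.
  by rewrite lerD //; apply/ltW/hK.
have ds : d * s%:C <= e / 2.
  by rewrite /d mulrAC ler_pdivrMr // ler_pM2l ?divr_gt0 // lerDl.
have : `|nu u0| + `|nu v| <= `|nu u0| + (e / 2 + e / 2).
  rewrite addrA; apply: (le_trans H); rewrite mulrDl mul1r.
  by apply: lerD => //; exact: ltW.
by rewrite lerD2l -splitr.
Qed.

Lemma ltrans_linear (x : G) (a : R[i]) (u v : C0) :
  ltrans x (a *: u + v) = a *: ltrans x u + ltrans x v.
Proof. exact: C0_ext. Qed.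

Lemma slice_C0 (nu : measure_alg) (u : C0) :
  continuous (fun x => nu (ltrans x u) : R[i]^o) /\
  vanishes_at_infinity (fun x => nu (ltrans x u)).
Proof.
split.
  move=> x; apply/cvgrPdist_lt => e e0.
  have [M M0 hM] := measure_alg_bounded_ge0 nu.
  have M1 : 0 < M + 1 by rewrite ltr_wpDl.
  have := ltrans_unif u (divr_gt0 e0 M1) => hu.
  have : \forall y \near x,
      forall z, `|u z - u (y * x^-1 * z)%g| < e / (M + 1).
    have cm : {for x, continuous (fun y : G => (y * x^-1)%g)}.
      apply: (@continuous_comp _ _ _ (fun y : G => (y, x^-1%g))
        (fun p : G * G => (p.1 * p.2)%g)); last exact: mulg_continuous.
      by apply: cvg_pair => //=; exact: cvg_cst.
    by have /= := cm _; rewrite /= mulgV => /(_ _ hu).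
  apply: filterS => y hy /=.
  have -> : nu (ltrans x u) - nu (ltrans y u) =
      nu (-1 *: ltrans y u + ltrans x u).
    by rewrite measure_alg_linear mulN1r addrC.
  apply: (@le_lt_trans _ _ (M * (e / (M + 1)))).
    apply: hM => z; rewrite C0_linearE mulN1r addrC.
    have := hy (x * z)%g; rewrite -mulgA mulKg.
    exact: ltW.
  by rewrite mulrA ltr_pdivrMr // mulrC ltr_pM2l // ltrDl.
move=> e e0.
have [r r0 ur] := C0_bounded u.
have [K [d [cK d0 hK]]] :=
  measure_alg_tight nu (divr_gt0 (divr_gt0 e0 r0) (ltr0n _ 2)).
have [L cL hL] := C0_vanishes u (mulr_gt0 d0 r0).
exists ((fun p : G * G => (p.1 * p.2^-1)%g) @` (L `*` K)).
  apply: continuous_compact; last exact: compact_setX.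
  apply: continuous_subspaceT => p.
  apply: (@continuous_comp _ _ _ (fun p : G * G => (p.1, p.2^-1%g))
    (fun p : G * G => (p.1 * p.2)%g)); last exact: mulg_continuous.
  apply: cvg_pair => /=; first exact: cvg_fst.
  apply: (@continuous_comp _ _ _ snd (fun x : G => (x^-1)%g)).
    exact: cvg_snd.
  exact: invg_continuous.
move=> x nx.
have : `|nu (r^-1 *: ltrans x u)| <= e / r / 2.
  have nr : `|r^-1| = r^-1 by rewrite ger0_norm ?invr_ge0 ?ltW.
  apply: hK => y; rewrite C0_scaleE normrM nr ler_pdivrMl //.
    by rewrite mulr1; exact: ur.
  move=> Ky; rewrite mulrC; apply/ltW/hL => Lxy; apply: nx.
  by exists ((x * y)%g, y) => //=; rewrite mulgK.
rewrite measure_algZ normrM ger0_norm ?invr_ge0 ?(ltW r0) //.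
have -> : e / r / 2 = r^-1 * (e / 2) by rewrite mulrAC mulrC.
rewrite ler_pM2l ?invr_gt0 // => /le_lt_trans; apply.
by rewrite ltr_pdivrMr // ltr_pMr // ltr1n.
Qed.

Definition slice (nu : measure_alg) (u : C0) : C0 := mkC0 (slice_C0 nu u).

Lemma convolution_subproof (mu nu : measure_alg) :
  (fun u : C0 => mu (slice nu u) : R[i]^o) \in measure_alg_pred.
Proof.
apply/asboolP; split.
  move=> a u v.
  rewrite -[RHS]/(a * mu (slice nu u) + mu (slice nu v)) -measure_alg_linear.
  congr (mu _); apply: C0_ext => x.
  by rewrite C0_linearE -[LHS]/(nu _) ltrans_linear measure_alg_linear.
have [M M0 hM] := measure_alg_bounded_ge0 mu.
have [N N0 hN] := measure_alg_bounded_ge0 nu.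
exists (M * N) => u r ur; rewrite -mulrA; apply: hM => x.
by apply: hN => y; exact: ur.
Qed.

(* The integral of u against mu * nu is
   \int_G \int_G u (x y) d nu(y) d mu(x). *)
Definition convolution (mu nu : measure_alg) : measure_alg :=
  exist _ (fun u : C0 => mu (slice nu u) : R[i]^o) (convolution_subproof mu nu).

Lemma convolutionE (mu nu : measure_alg) (u : C0) :
  convolution mu nu u = mu (slice nu u).
Proof. by []. Qed.

End C0.

Definition is_compact_subgroup (G : lcGroupType) (A : set G) : Prop :=
  [/\ compact A, A 1%g, forall x y, A x -> A y -> A (x * y)%g
    & forall x, A x -> A (x^-1)%g].

Record compact_subgroup (G : lcGroupType) := CompactSubgroup {
  carrier :> set G;
  carrierP : is_compact_subgroup carrier
}.

Definition setmulg (G : lcGroupType) (A B : set G) : set G :=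
  [set (a * b)%g | a in A & b in B].

(* Only the values on K are meaningful. *)
Record character (R : realType) (G : lcGroupType) (K : compact_subgroup G) :=
  Character {
    character_fun :> G -> R[i];
    character_continuous : {within K, continuous (character_fun : G -> R[i]^o)};
    characterM : forall x y, carrier K x -> carrier K y ->
      character_fun (x * y)%g = character_fun x * character_fun y;
    character_norm1 : forall x, carrier K x -> `|character_fun x| = 1
  }.

(* The normalised Haar measure of K, pushed forward to G: a regular Borel
   probability on G that is concentrated on K and invariant under K. *)
Record haar_measure (R : realType) (G : lcGroupType) (K : compact_subgroup G) :=
  HaarMeasure {
    haar :> probability (borel G) R;
    haar_normalised : haar K = 1%E;
    haar_invariant : forall (k : G) (E : set (borel G)),
      carrier K k -> measurable E -> haar [set (k * x)%g | x in E] = haar E;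
    haar_outer_regular : forall E : set (borel G), measurable E ->
      haar E =
        ereal_inf [set haar U | U in [set U : set G | open U /\ E `<=` U]];
    haar_inner_regular : forall E : set (borel G), measurable E ->
      haar E =
        ereal_sup [set haar C | C in [set C : set G | compact C /\ C `<=` E]]
  }.

Definition cintegral d (T : measurableType d) (R : realType)
    (m : {measure set T -> \bar R}) (D : set T) (f : T -> R[i]) : R[i] :=
  (\int[m]_(x in D) complex.Re (f x)) +i* (\int[m]_(x in D) complex.Im (f x)).

Section character_measure.
Variables (R : realType) (G : lcGroupType) (K : compact_subgroup G).

Lemma subgroup_measurable : measurable (K : set (borel G)).
Proof.
have [cK _ _ _] := carrierP K.
have clK : closed K := compact_closed (@group_hausdorff G) cK.
rewrite -[X in measurable X]setCK; apply: measurableC.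
by apply: sub_sigma_algebra; exact: closed_openC.
Qed.

Lemma normr_Re (z : R[i]) : `|complex.Re z|%:C <= `|z|.
Proof. exact: normc_ge_Re. Qed.

Lemma Im_Re (z : R[i]) : complex.Im z = complex.Re (- 'i%C * z).
Proof. by rewrite mulrC mulrN raddfN /= ReiNIm opprK. Qed.

Lemma normr_Im (z : R[i]) : `|complex.Im z|%:C <= `|z|.
Proof.
rewrite Im_Re; apply: (le_trans (normr_Re _)).
rewrite normrM normrN; case: z => a b.
by rewrite !normc_def /= expr0n expr1n add0r sqrtr1 mul1r.
Qed.

Lemma Re_continuous : continuous (fun z : R[i]^o => complex.Re z).
Proof.
move=> z; apply/(@cvgrPdist_lt _ R _ (nbhs (z : R[i]^o))) => e e0.
have e0c : 0 < e%:C :> R[i] by rewrite ltcR.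
have near_z : \forall w \near (z : R[i]^o), `|z - w| < e%:C.
  by apply/nbhs_ballP; exists e%:C.
apply: filterS near_z => w /= hw; rewrite -raddfB /= -ltcR.
exact: le_lt_trans (normr_Re _) hw.
Qed.

Lemma within_measurable_Re (f : G -> R[i]) :
  {within K, continuous (f : G -> R[i]^o)} ->
  measurable_fun (K : set (borel G)) (fun x => complex.Re (f x)).
Proof.
move=> cf.
have cRf : {within K, continuous (fun x => complex.Re (f x))}.
  move=> x; apply: (@continuous_comp _ _ _ (f : subspace K -> R[i]^o)) => //.
    exact: cf.
  exact: Re_continuous.
have mK := subgroup_measurable.
apply: (measurability _ (measurable_realfun.RGenOpens.measurableE R)).
move=> _ [_ [a [b ->] <-]].
have oab :
    open ((fun x : subspace K => complex.Re (f x)) @^-1` `]a, b[%classic).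
  have /continuousP cP :
    continuous (fun x : subspace K => complex.Re (f x)) := cRf.
  by apply: cP; exact: interval_open.
have /open_subspaceP[V oV VK] := oab.
rewrite setIC -VK; apply: measurableI => //.
exact: sub_sigma_algebra.
Qed.

Lemma within_integrable_Re (m : haar_measure R K) (f : G -> R[i]) (r : R[i]) :
  {within K, continuous (f : G -> R[i]^o)} ->
  (forall x, carrier K x -> `|f x| <= r) ->
  m.-integrable (K : set (borel G)) (EFin \o (fun x => complex.Re (f x))).
Proof.
move=> cf fr; apply: measurable_bounded_integrable.
- exact: subgroup_measurable.
- by have /= -> := haar_normalised m; rewrite ltry.
- exact: within_measurable_Re.
exists (complex.Re r); split; first exact: num_real.
move=> M rM x Kx /=; apply: le_trans (ltW rM).
have : `|complex.Re (f x)|%:C <= r := le_trans (normr_Re _) (fr _ Kx).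
by rewrite lecE => /andP[].
Qed.

Lemma within_Im (f : G -> R[i]) : {within K, continuous (f : G -> R[i]^o)} ->
  {within K, continuous ((fun x => - 'i%C * f x) : G -> R[i]^o)}.
Proof. by move=> cf x; apply: cvgZl_tmp; exact: cf. Qed.

Lemma within_integrable_Im (m : haar_measure R K) (f : G -> R[i]) (r : R[i]) :
  {within K, continuous (f : G -> R[i]^o)} ->
  (forall x, carrier K x -> `|f x| <= r) ->
  m.-integrable (K : set (borel G)) (EFin \o (fun x => complex.Im (f x))).
Proof.
move=> cf fr; rewrite (_ : (fun x => _) = (fun x => complex.Re (- 'i%C * f x))).
  apply: (@within_integrable_Re _ _ r); first exact: within_Im.
  move=> x Kx; rewrite normrM normrN [`|'i%C|]normc_def /= expr0n expr1n add0r.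
  by rewrite sqrtr1 mul1r; exact: fr.
by apply/funext => x; rewrite Im_Re.
Qed.

Lemma Rintegral_le (m : haar_measure R K) (g : borel G -> R) (r : R) :
  m.-integrable K (EFin \o g) -> (forall x, carrier K x -> `|g x| <= r) ->
  `|\int[m]_(x in K) g x| <= r.
Proof.
move=> ig gr; have mK := subgroup_measurable.
apply: (le_trans (le_normr_Rintegral mK ig)).
have -> : r = \int[m]_(x in K) (cst r x).
  by rewrite Rintegral_cst //; have /= -> := haar_normalised m; rewrite mulr1.
apply: le_Rintegral => //.
- exact: integrable_norm.
- exact: finite_measure_integrable_cst.
Qed.

Variables (m : haar_measure R K) (rho : character R K).

Lemma character_continuous_mul (u : C0 R G) :
  {within K, continuous ((fun x => u x * rho x) : G -> R[i]^o)}.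
Proof.
move=> x; apply: (@cvgM _ _ (nbhs (x : subspace K))); last first.
  exact: character_continuous.
exact: (continuous_subspaceT (@C0_continuous R G u)).
Qed.

Lemma character_measure_subproof :
  (fun u : C0 R G => cintegral m K (fun x => u x * rho x) : R[i]^o)
    \in @measure_alg_pred R G.
Proof.
have mK := subgroup_measurable.
have ub (u : C0 R G) r : (forall x, `|u x| <= r) ->
    forall x, carrier K x -> `|u x * rho x| <= r.
  by move=> ur x Kx; rewrite normrM character_norm1 // mulr1.
have ir (u : C0 R G) :
    m.-integrable (K : set (borel G))
      (EFin \o (fun x => complex.Re (u x * rho x))).
  have [r _ ur] := C0_bounded u.
  apply: within_integrable_Re; first exact: character_continuous_mul.
  exact: ub ur.
have ii (u : C0 R G) :
    m.-integrable (K : set (borel G))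
      (EFin \o (fun x => complex.Im (u x * rho x))).
  have [r _ ur] := C0_bounded u.
  apply: within_integrable_Im; first exact: character_continuous_mul.
  exact: ub ur.
apply/asboolP; split; last first.
  exists 2 => u r ur.
  have r0 : 0 <= r := le_trans (normr_ge0 _) (ur 1%g).
  have rE : r = (complex.Re r)%:C by rewrite RRe_real // ger0_real.
  rewrite /cintegral [X in `|X|]complexE /= mulr_natl mulr2n.
  apply: (le_trans (ler_normD _ _)); apply: lerD.
    rewrite normc_def /= expr0n addr0 sqrtr_sqr rE lecR.
    apply: Rintegral_le => // x Kx.
    by rewrite -lecR -rE; exact: le_trans (normr_Re _) (ub _ _ ur _ Kx).
  rewrite normrM [X in _ * X]normc_def normc_def /= !expr0n expr1n addr0 add0r.
  rewrite sqrtr1 mul1r sqrtr_sqr rE lecR.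
  apply: Rintegral_le => // x Kx.
  by rewrite -lecR -rE; exact: le_trans (normr_Im _) (ub _ _ ur _ Kx).
suff lin (a : R[i]) (u v : C0 R G) :
    cintegral m K (fun x => (a *: u + v : C0 R G) x * rho x) =
    a * cintegral m K (fun x => u x * rho x) +
    cintegral m K (fun x => v x * rho x).
  by move=> a u v; exact: lin.
rewrite /cintegral.
have ReE x : complex.Re ((a *: u + v : C0 R G) x * rho x) =
  complex.Re a * complex.Re (u x * rho x) +
  ((- complex.Im a) * complex.Im (u x * rho x) + complex.Re (v x * rho x)).
  rewrite C0_linearE mulrDl -mulrA raddfD /=.
  case: a (u x * rho x) => a b [c d] /=; by rewrite mulNr addrA.
have ImE x : complex.Im ((a *: u + v : C0 R G) x * rho x) =
  complex.Re a * complex.Im (u x * rho x) +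
  (complex.Im a * complex.Re (u x * rho x) + complex.Im (v x * rho x)).
  rewrite C0_linearE mulrDl -mulrA raddfD /=.
  case: a {ReE} (u x * rho x) => a b [c d] /=; by rewrite addrA.
rewrite (funext ReE) (funext ImE).
have iZ (c : R) (g : borel G -> R) : m.-integrable K (EFin \o g) ->
    m.-integrable K (EFin \o (fun x => c * g x)).
  exact: integrableZl.
have iD (g h : borel G -> R) : m.-integrable K (EFin \o g) ->
    m.-integrable K (EFin \o h) ->
    m.-integrable K (EFin \o (fun x => g x + h x)).
  exact: integrableD.
rewrite !RintegralD ?RintegralZl //; do ?[apply: iD|apply: iZ] => //.
case: a {ReE ImE} => a b.
by rewrite /=; congr (_ +i* _); rewrite /= ?mulNr !addrA.
Qed.

Definition character_measure : measure_alg R G :=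
  exist _ (fun u : C0 R G => cintegral m K (fun x => u x * rho x) : R[i]^o)
    character_measure_subproof.

Lemma character_measureE (u : C0 R G) :
  character_measure u = cintegral m K (fun x => u x * rho x).
Proof. by []. Qed.

End character_measure.

Section haar_element.
Variables (R : realType) (G : lcGroupType) (K : compact_subgroup G).

Lemma trivial_character_continuous :
  {within K, continuous ((fun=> 1) : G -> R[i]^o)}.
Proof. by apply: continuous_subspaceT => x; exact: cvg_cst. Qed.

Definition trivial_character : character R K :=
  @Character R G K (fun=> 1) trivial_character_continuous
    (fun _ _ _ _ => esym (mulr1 1)) (fun _ _ => normr1 _).

(* m_K itself, as an element of M(G). *)
Definition haar_element (m : haar_measure R K) : measure_alg R G :=
  character_measure m trivial_character.

Lemma haar_elementE (m : haar_measure R K) (u : C0 R G) :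
  haar_element m u = cintegral m K u.
Proof.
rewrite character_measureE; congr cintegral.
by apply/funext => x; rewrite mulr1.
Qed.

End haar_element.

(* Main.v *)
(* Left invariance turns the translate of [rho m_K] by [k] in [K] into the multiple
   [(rho k)^-1] of it. If [rho1] and [rho2] differ at some [k] in [K1 & K2], moving
   [k] across the product [x y = (x k) (k^-1 y)] multiplies the convolution by
   [rho1 k / rho2 k <> 1], so it vanishes. If they agree on [K1 & K2], the support
   of the convolution is all of [K1 K2], since [rho1 x * rho2 y] depends only on
   [x y] and there is no cancellation; when the measures commute this gives
   [K1 K2 = K2 K1], and [rho] is the factor by which translations act on the
   nonzero functional [mu1 * mu2]. Conversely, by invariance of the Haar measure of
   the group [K1 K2] on both sides, integrating over it amounts to integrating over
   [K1] and [K2] successively. *)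

Require Import Defs.
From HB Require Import structures.
From mathcomp Require Import all_boot all_order all_algebra.
From mathcomp Require Import all_classical all_reals all_analysis complex.
From mathcomp Require Import measurable_realfun.

Set Implicit Arguments.
Unset Strict Implicit.
Unset Printing Implicit Defensive.

Import Order.TTheory GRing.Theory Num.Theory numFieldNormedType.Exports.

Local Open Scope classical_set_scope.
Local Open Scope complex_scope.
Local Open Scope ring_scope.

(** * Continuity within subsets, and uniformity over compact sets *)

Lemma within_comp (S T U : topologicalType) (A : set S) (B : set T)
    (f : S -> U) (g : T -> S) :
  continuous g -> (forall x, B x -> A (g x)) ->
  {within A, continuous f} -> {within B, continuous (fun x => f (g x))}.
Proof.
move=> cg BA /subspace_continuousP cf; apply/subspace_continuousP => x Bx.
apply: cvg_trans (cf _ (BA _ Bx)) => W /= fW.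
have : nbhs (g x) [set y | A y -> W (f y)] := fW.
move=> /(cg x); rewrite /nbhs /= /within /=.
by apply: filterS => y /= h By; apply/h/BA.
Qed.

Lemma within_comp_continuous (S T U : topologicalType) (A : set S)
    (f : S -> T) (g : T -> U) :
  continuous g -> {within A, continuous f} ->
  {within A, continuous (fun x => g (f x))}.
Proof. by move=> cg cf x; apply: continuous_comp; [exact: cf|exact: cg]. Qed.

Lemma within_near (T : topologicalType) (F : numFieldType)
    (V : normedModType F) (A : set T) (f : T -> V) (x : T) (e : F) :
  {within A, continuous f} -> A x -> 0 < e ->
  \forall y \near x, A y -> `|f x - f y| < e.
Proof.
move=> /subspace_continuousP cf Ax e0.
have /cvgr_dist_lt /(_ _ e0) := cf _ Ax.
exact.
Qed.

Lemma near_within (T : topologicalType) (F : numFieldType)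
    (V : normedModType F) (A : set T) (f : T -> V) :
  (forall x e, A x -> 0 < e -> \forall y \near x, A y -> `|f x - f y| < e) ->
  {within A, continuous f}.
Proof.
move=> h; apply/subspace_continuousP => x Ax.
by apply/cvgrPdist_lt => e e0; exact: h.
Qed.

Section group_continuity.
Variable G : lcGroupType.

Lemma mulg_continuous_comp (T : topologicalType) (f g : T -> G) :
  continuous f -> continuous g -> continuous (fun x => f x * g x)%g.
Proof.
move=> cf cg x; apply: (@continuous_comp _ _ _ (fun x => (f x, g x))
  (fun p : G * G => (p.1 * p.2)%g)); last exact: mulg_continuous.
by apply: cvg_pair; [exact: cf|exact: cg].
Qed.

Lemma invg_continuous_comp (T : topologicalType) (f : T -> G) :
  continuous f -> continuous (fun x => (f x)^-1)%g.
Proof.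
move=> cf x; apply: (@continuous_comp _ _ _ f (fun y : G => (y^-1)%g)).
  exact: cf.
exact: invg_continuous.
Qed.

End group_continuity.

Lemma fst_continuous (S T : topologicalType) :
  continuous (fun p : S * T => p.1).
Proof. by move=> p; exact: cvg_fst. Qed.

Lemma snd_continuous (S T : topologicalType) :
  continuous (fun p : S * T => p.2).
Proof. by move=> p; exact: cvg_snd. Qed.

(** For each [y] in [B], continuity gives a product neighbourhood of [(x, y)] on which [h x' y'] and
    [h x y'] both lie within [e / 2] of [h x y]; compactness of [B] leaves a single neighbourhood of
    [x]. *)
Lemma compact_tube (S T : topologicalType) (F : numFieldType)
    (V : normedModType F) (A : set S) (B : set T) (h : S -> T -> V)
    (x : S) (e : F) :
  compact B -> {within A `*` B, continuous (fun p => h p.1 p.2)} ->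
  A x -> 0 < e ->
  \forall x' \near x, A x' -> forall y, B y -> `|h x y - h x' y| < e.
Proof.
move=> cB ch Ax e0; have e20 : 0 < e / 2 by rewrite divr_gt0.
(* Covering neighbourhoods live in the ambient spaces, so membership in [A] and [B] is carried as a
   premise inside the covered set. *)
have : \forall x' \near x,
    B `<=` [set y | B y -> A x' -> `|h x y - h x' y| < e].
  apply: (@compact_near_coveringP T B).1 cB _ _ _ _ _ => y By.
  have near_xy := within_near ch (conj Ax By : (A `*` B) (x, y)) e20.
  have near_yx : \forall p \near (y, x), (A `*` B) (p.2, p.1) ->
      `|h x y - h p.2 p.1| < e / 2.
    have cs : continuous (fun p : T * S => (p.2, p.1)).
      by move=> p; apply: cvg_pair; [exact: cvg_snd|exact: cvg_fst].
    exact: (cs (y, x) _ near_xy).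
  have near_y : \forall p \near (y, x), (A `*` B) (x, p.1) ->
      `|h x y - h x p.1| < e / 2.
    have cs : continuous (fun p : T * S => (x, p.1)).
      by move=> p; apply: cvg_pair => /=; [exact: cvg_cst|exact: cvg_fst].
    exact: (cs (y, x) _ near_xy).
  apply: filterS2 near_yx near_y => -[y' x'] /= h1 h2 By' Ax'.
  rewrite [e]splitr; apply: (le_lt_trans (ler_distD (h x y) _ _)).
  by apply: ltrD; [rewrite distrC; exact: h2|exact: h1].
by apply: filterS => x' h' Ax' y By; exact: h'.
Qed.

Section compact_subgroups.
Variables (G : lcGroupType) (K : compact_subgroup G).

Lemma carrier_compact : compact K.
Proof. by case: (carrierP K). Qed.

Lemma carrier1 : carrier K 1%g.
Proof. by case: (carrierP K). Qed.

Lemma carrierM x y : carrier K x -> carrier K y -> carrier K (x * y)%g.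
Proof. by case: (carrierP K) => _ _ + _; exact. Qed.

Lemma carrierV x : carrier K x -> carrier K (x^-1)%g.
Proof. by case: (carrierP K) => _ _ _; exact. Qed.

End compact_subgroups.

Lemma ofreal_continuous (R : realType) :
  continuous ((fun x : R => x%:C) : R -> R[i]^o).
Proof.
move=> x; apply/cvgrPdist_lt => e e0.
have eE : e = (complex.Re e)%:C by rewrite RRe_real // gtr0_real.
have e0' : 0 < complex.Re e by rewrite -ltcR -eE.
have : \forall y \near x, `|x - y| < complex.Re e.
  by apply/nbhs_ballP; exists (complex.Re e).
apply: filterS => y; rewrite -ltcR -eE; apply: le_lt_trans.
by rewrite -rmorphB /= normc_def /= expr0n addr0 sqrtr_sqr.
Qed.

(** * Haar integrals of continuous functions and left invariance *)

Section haar_integral.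
Variables (R : realType) (G : lcGroupType) (K : compact_subgroup G).
Variable m : haar_measure R K.
Implicit Type f : G -> R.

Lemma within_bounded f : {within K, continuous f} ->
  exists r, forall x, carrier K x -> `|f x| <= r.
Proof.
move=> cf.
have /compact_bounded[M [_ hM]] := continuous_compact cf (@carrier_compact G K).
exists (M + 1) => x Kx; apply: (hM (M + 1)); first by rewrite ltrDl.
by exists x.
Qed.

Lemma within_measurable f : {within K, continuous f} ->
  measurable_fun (K : set (borel G)) f.
Proof.
move=> cf; apply: (@within_measurable_Re R G K (fun x => (f x)%:C)).
exact: (within_comp_continuous (@ofreal_continuous R) cf).
Qed.

Lemma within_integrable f : {within K, continuous f} ->
  m.-integrable (K : set (borel G)) (EFin \o f).
Proof.
move=> cf; apply: measurable_bounded_integrable.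
- exact: subgroup_measurable.
- by have /= -> := haar_normalised m; rewrite ltry.
- exact: within_measurable.
have [r fr] := within_bounded cf.
exists r; split; first exact: num_real.
by move=> M rM x Kx /=; apply: le_trans (ltW rM); exact: fr.
Qed.

Lemma haar_cst (r : R) : \int[m]_(x in K) r = r.
Proof.
rewrite (Rintegral_cst _ (subgroup_measurable K)).
by have /= -> := haar_normalised m; rewrite mulr1.
Qed.

Lemma haar_ext f g : (forall x, carrier K x -> f x = g x) ->
  \int[m]_(x in K) f x = \int[m]_(x in K) g x.
Proof. by move=> fg; apply: eq_Rintegral => x /set_mem; exact: fg. Qed.

Lemma lmul_measurable (k : G) :
  measurable_fun [set: borel G] (fun x : borel G => (k * x)%g : borel G).
Proof.
apply: (@measurability _ _ (borel G) (borel G) setT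
  (fun x : borel G => (k * x)%g : borel G) (@open G) erefl).
move=> _ [U oU <-]; rewrite setTI; apply: sub_sigma_algebra.
by move: oU; apply: (@continuousP G G _).1; exact: lmul_continuous.
Qed.

(** A change of variables along [x |-> k * x], which maps [K] onto itself and pushes [m] forward to
    [m]. *)
Lemma haar_lmul f (k : G) : {within K, continuous f} -> carrier K k ->
  \int[m]_(x in K) f (k * x)%g = \int[m]_(x in K) f x.
Proof.
move=> cf Kk; have mK := subgroup_measurable K.
(* Cutting [f] off outside [K] yields a function measurable on all of [G], the form required by the
   pushforward formula. *)
pose F : borel G -> \bar R := EFin \o (f \_ K).
have mF : measurable_fun [set: borel G] F.
  apply/measurable_EFinP.
  by apply/(measurable_restrictT _ mK); exact: within_measurable.
have phiK : (fun x : borel G => (k * x)%g : borel G) @^-1` K = K.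
  apply/seteqP; split=> x /= Kx; last exact: carrierM.
  by rewrite -[x](mulKg k); apply: carrierM => //; exact: carrierV.
have cfk : {within K, continuous (fun x => f (k * x)%g)}.
  apply: within_comp cf; first exact: lmul_continuous.
  by move=> x; exact: carrierM.
have FE x : carrier K x -> F x = (f x)%:E.
  by move=> Kx; rewrite /F /= /patch mem_set.
have iF : m.-integrable ((fun x : borel G => (k * x)%g : borel G) @^-1` K)
    (F \o (fun x : borel G => (k * x)%g : borel G)).
  rewrite phiK; apply: eq_integrable (within_integrable cfk) => //.
  by move=> x /set_mem Kx /=; rewrite FE //; exact: carrierM.
have := integral_pushforward (lmul_measurable k) mF iF mK.
rewrite (eq_measure_integral m) ?phiK; last first.
  (* The preimage of [A] under multiplication by [k] is the translate of [A] by [k^-1]. *)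
  move=> ? A mA _ /=; rewrite /pushforward -[RHS](haar_invariant m (carrierV Kk) mA).
  congr (m _); apply/seteqP; split=> x /=.
    by move=> Ax; exists (k * x)%g => //; rewrite mulKg.
  by case=> y Ay <-; rewrite mulVKg.
  exact: lmul_measurable.
move=> H; rewrite /Rintegral; congr fine.
transitivity (\int[m]_(x in K) (F \o (fun x : borel G => (k * x)%g : borel G)) x)%E.
  by apply: eq_integral => x /set_mem Kx; rewrite /comp FE //; exact: carrierM.
by rewrite -H; apply: eq_integral => x /set_mem Kx; rewrite FE.
Qed.

End haar_integral.

(** * Algebra and slices of functions continuous within a set *)

Section within_real.
Variables (R : realType) (T : topologicalType) (A : set T).
Implicit Types f g : T -> R.

Lemma within_cst (r : R) : {within A, continuous (fun=> r)}.
Proof. by apply: continuous_subspaceT => x; exact: cvg_cst. Qed.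

Lemma within_add f g : {within A, continuous f} -> {within A, continuous g} ->
  {within A, continuous (fun x => f x + g x)}.
Proof.
by move=> cf cg x; apply: (@cvgD _ _ _ (nbhs (x : subspace A)));
  [exact: cf|exact: cg].
Qed.

Lemma within_sub f g : {within A, continuous f} -> {within A, continuous g} ->
  {within A, continuous (fun x => f x - g x)}.
Proof.
by move=> cf cg x; apply: (@cvgB _ _ _ (nbhs (x : subspace A)));
  [exact: cf|exact: cg].
Qed.

Lemma within_mul f g : {within A, continuous f} -> {within A, continuous g} ->
  {within A, continuous (fun x => f x * g x)}.
Proof.
by move=> cf cg x; apply: (@cvgM _ _ (nbhs (x : subspace A)));
  [exact: cf|exact: cg].
Qed.

Lemma within_sum (I : eqType) (s : seq I) (F : I -> T -> R) :
  (forall i, i \in s -> {within A, continuous (F i)}) ->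
  {within A, continuous (fun x => \sum_(i <- s) F i x)}.
Proof.
elim: s => [|i s IH] cF.
  by under eq_fun do rewrite big_nil; exact: within_cst.
under eq_fun do rewrite big_cons.
apply: within_add; first by apply: cF; rewrite mem_head.
by apply: IH => j js; apply: cF; rewrite inE js orbT.
Qed.

End within_real.

Section within_prod.
Variables (S T U : topologicalType) (A : set S) (B : set T) (h : S -> T -> U).
Hypothesis ch : {within A `*` B, continuous (fun p => h p.1 p.2)}.

Lemma within_slice_l y : B y -> {within A, continuous (fun x => h x y)}.
Proof.
move=> By; apply: (within_comp (g := fun x => (x, y))) ch => //.
by move=> x; apply: cvg_pair => /=; [exact: cvg_id|exact: cvg_cst].
Qed.

Lemma within_slice_r x : A x -> {within B, continuous (h x)}.
Proof.
move=> Ax; apply: (within_comp (g := fun y => (x, y))) ch => //.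
by move=> y; apply: cvg_pair => /=; [exact: cvg_cst|exact: cvg_id].
Qed.

Lemma within_swap : {within B `*` A, continuous (fun p => h p.2 p.1)}.
Proof.
apply: (within_comp (g := fun p => (p.2, p.1))) ch => [p|p []//].
by apply: cvg_pair; [exact: cvg_snd|exact: cvg_fst].
Qed.

End within_prod.

(** * Linearity, positivity and finite-sum approximation of Haar integrals *)

Section haar_positivity.
Variables (R : realType) (G : lcGroupType) (K : compact_subgroup G).
Variable m : haar_measure R K.
Implicit Type f : G -> R.

Lemma haar_add f g : {within K, continuous f} -> {within K, continuous g} ->
  \int[m]_(x in K) (f x + g x) = \int[m]_(x in K) f x + \int[m]_(x in K) g x.
Proof.
move=> cf cg; apply: RintegralD; first exact: subgroup_measurable.
  exact: within_integrable cf.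
exact: within_integrable cg.
Qed.

Lemma haar_sub f g : {within K, continuous f} -> {within K, continuous g} ->
  \int[m]_(x in K) (f x - g x) = \int[m]_(x in K) f x - \int[m]_(x in K) g x.
Proof.
move=> cf cg; apply: RintegralB; first exact: subgroup_measurable.
  exact: within_integrable cf.
exact: within_integrable cg.
Qed.

Lemma haar_scale f (r : R) : {within K, continuous f} ->
  \int[m]_(x in K) (r * f x) = r * \int[m]_(x in K) f x.
Proof.
move=> cf; apply: RintegralZl; first exact: subgroup_measurable.
exact: within_integrable cf.
Qed.

Lemma haar_sum (I : eqType) (s : seq I) (F : I -> G -> R) :
  (forall i, i \in s -> {within K, continuous (F i)}) ->
  \int[m]_(x in K) (\sum_(i <- s) F i x) =
  \sum_(i <- s) \int[m]_(x in K) F i x.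
Proof.
elim: s => [|i s IH] cF.
  rewrite big_nil -[RHS](haar_cst m 0).
  by apply: haar_ext => x _; rewrite big_nil.
have cs : forall j, j \in s -> {within K, continuous (F j)}.
  by move=> j js; apply: cF; rewrite inE js orbT.
rewrite big_cons -IH // -haar_add; last exact: within_sum.
  by apply: haar_ext => x _; rewrite big_cons.
by apply: cF; rewrite mem_head.
Qed.

Lemma haar_le f g : {within K, continuous f} -> {within K, continuous g} ->
  (forall x, carrier K x -> f x <= g x) ->
  \int[m]_(x in K) f x <= \int[m]_(x in K) g x.
Proof.
move=> cf cg fg; apply: le_Rintegral => //; first exact: subgroup_measurable.
  exact: within_integrable cf.
exact: within_integrable cg.
Qed.

Lemma haar_norm_le f (r : R) : {within K, continuous f} ->
  (forall x, carrier K x -> `|f x| <= r) -> `|\int[m]_(x in K) f x| <= r.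
Proof. by move=> cf fr; apply: Rintegral_le => //; exact: within_integrable. Qed.

(** Interiors turn the neighbourhoods into an open cover; being open, they are also Borel sets, as
    the partition in [haar_quadrature] requires. *)
Lemma finite_cover (E : G -> set G) : (forall x, carrier K x -> nbhs x (E x)) ->
  exists2 s : seq G, (forall x, x \in s -> carrier K x) &
    forall x, carrier K x -> exists2 k, k \in s & (interior (E k)) x.
Proof.
move=> EK; have := @carrier_compact G K; rewrite compact_cover.
case/(_ G (carrier K) (fun k => interior (E k))).
- by move=> k _; exact: open_interior.
- by move=> x Kx; exists x => //; exact: EK.
move=> D DK KD; exists (finmap.enum_fset D).
  by move=> x xD; have := DK x xD; rewrite inE.
by move=> x /KD [k kD Ex]; exists k.
Qed.

(* Finitely many translates of [f] have a sum bounded below on [K]. *)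
Lemma haar_gt0 f a : {within K, continuous f} ->
  (forall x, carrier K x -> 0 <= f x) -> carrier K a -> 0 < f a ->
  0 < \int[m]_(x in K) f x.
Proof.
move=> cf f0 Ka fa; pose d := f a / 2.
have d0 : 0 < d by rewrite divr_gt0.
have near_a := within_near cf Ka d0.
(* The map [x |-> a * (k^-1 * x)] sends [k] to [a], so by continuity [E k] is a neighbourhood of
   [k]: the corresponding translate of [f] exceeds [d] there. *)
pose E k := [set x | carrier K (a * (k^-1 * x))%g -> d < f (a * (k^-1 * x))%g].
have [|s sK Ks] := @finite_cover E.
  move=> k Kk.
  have ck : continuous (fun x : G => a * (k^-1 * x))%g.
    apply: mulg_continuous_comp; first by move=> ?; exact: cvg_cst.
    exact: lmul_continuous.
  have near_k : \forall x \near k, carrier K (a * (k^-1 * x))%g ->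
      `|f a - f (a * (k^-1 * x))%g| < d.
    by have := ck k _; rewrite mulVg mulg1 => /(_ _ near_a).
  apply: filterS near_k => x /= h Kx; have := h Kx.
  move=> /(le_lt_trans (ler_norm _)); rewrite ltrBlDl -ltrBlDr.
  by rewrite /d {1}[f a]splitr addrK.
have Kt k : k \in s -> forall x, carrier K x -> carrier K (a * (k^-1 * x))%g.
  move=> ks x Kx; apply: carrierM => //; apply: carrierM => //.
  by apply: carrierV; exact: sK.
have ct k : k \in s -> {within K, continuous (fun x => f (a * (k^-1 * x))%g)}.
  move=> ks; apply: within_comp cf; last exact: Kt.
  apply: mulg_continuous_comp; first by move=> ?; exact: cvg_cst.
  exact: lmul_continuous.
have : d <= (size s)%:R * \int[m]_(x in K) f x.
  have -> : (size s)%:R * \int[m]_(x in K) f x =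
      \int[m]_(x in K) \sum_(k <- s) f (a * (k^-1 * x))%g.
    rewrite haar_sum // big_seq (eq_bigr (fun=> \int[m]_(x in K) f x)).
      by rewrite -big_seq big_const_seq count_predT iter_addr_0 mulr_natl.
    move=> k ks; have Kk := sK _ ks.
    have KVk := carrierV Kk.
    rewrite -[RHS](haar_lmul m cf (carrierM Ka KVk)).
    by apply: haar_ext => x _; rewrite mulgA.
  rewrite -{1}[d](haar_cst m); apply: haar_le.
  - exact: within_cst.
  - exact: within_sum.
  move=> x Kx; have [k ks /interior_subset /= Ex] := Ks x Kx.
  (* The translate attached to the neighbourhood containing [x] already exceeds [d]; all others are
     nonnegative. *)
  rewrite (perm_big _ (perm_to_rem ks)) /= big_cons.
  apply: ler_wpDr; last by apply/ltW/Ex/Kt.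
  rewrite big_seq sumr_ge0 // => j /mem_rem js.
  by apply: f0; exact: Kt.
(* The number of translates is positive because [a] itself is covered, so the factor can be
   cancelled. *)
move=> /(lt_le_trans d0); rewrite pmulr_rgt0 // ltr0n lt0n size_eq0.
by apply/eqP => s0; have [k] := Ks a Ka; rewrite s0.
Qed.

(* The nodes and weights depend on the neighbourhoods [E] only, so they serve all
   integrands with small oscillation along [E] simultaneously. *)
Lemma haar_quadrature (E : G -> set G) (e : R) :
  (forall x, carrier K x -> nbhs x (E x)) ->
  exists2 s : seq (R * G), (forall p, p \in s -> carrier K p.2) &
    forall f, {within K, continuous f} ->
      (forall x y, carrier K x -> carrier K y -> E x y -> `|f x - f y| <= e) ->
      `|\int[m]_(x in K) f x - \sum_(p <- s) p.1 * f p.2| <= e.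
Proof.
move=> EK; have mK := subgroup_measurable K.
pose close f := {within K, continuous f} /\ forall x y, carrier K x ->
  carrier K y -> E x y -> `|f x - f y| <= e.
(* Generalised from [K] to a Borel subset [D] covered by the list [l], with error [e] times the mass
   of [D], so that induction on [l] can remove one neighbourhood at a time. *)
suff H (l : seq G) (D : set (borel G)) : (forall x, x \in l -> carrier K x) ->
    measurable D -> D `<=` K ->
    (forall x, D x -> exists2 k, k \in l & (interior (E k)) x) ->
    exists2 s : seq (R * G), (forall p, p \in s -> carrier K p.2) &
    forall f, close f ->
      `|\int[m]_(x in D) f x - \sum_(p <- s) p.1 * f p.2|
        <= \int[m]_(x in D) e.
  have [l lK Kl] := finite_cover EK.
  have [s sK hs] := H l K lK mK (@subset_refl _ _) Kl.
  exists s => // f cf fe; rewrite -[leRHS](haar_cst m).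
  by apply: hs; split.
elim: l D => [|k l IH] D lK mD DK Dl.
  exists [::] => // f _.
  have -> : D = set0.
    by apply/seteqP; split=> // x /Dl [].
  by rewrite !Rintegral_set0 big_nil subrr normr0.
have mU : measurable (interior (E k) : set (borel G)).
  by apply: sub_sigma_algebra; exact: open_interior.
(* [A] contributes the node [k] with weight [m A], where [k] need not lie in [D]; [B] is covered by
   the remaining points. *)
pose A : set (borel G) := D `&` interior (E k).
pose B : set (borel G) := D `\` interior (E k).
have mA : measurable A by exact: measurableI.
have mB : measurable B by exact: measurableD.
have AB : [disjoint A & B].
  by apply/disj_setPS => x [[_ ?] []].
have DE : D = A `|` B by rewrite /A /B setUIDK.
have AK : A `<=` K by move=> x [/DK].
have BK : B `<=` K by move=> x [/DK].
have [||s sK hs] := IH B _ mB BK.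
- by move=> x xl; apply: lK; rewrite inE xl orbT.
- move=> x [Dx nEx]; have [j] := Dl x Dx.
  by rewrite inE => /predU1P[->//|jl ?]; exists j.
have Kk : carrier K k by apply: lK; rewrite mem_head.
exists ((fine (m A), k) :: s).
  by move=> p; rewrite inE => /predU1P[->//|/sK].
move=> f [cf fe].
have iS (D' : set (borel G)) g : D' `<=` K -> measurable D' ->
    {within K, continuous g} -> m.-integrable D' (EFin \o g).
  by move=> D'K mD' cg; apply: integrableS (within_integrable m cg).
have cc (r : R) : {within K, continuous (fun=> r)} by exact: within_cst.
rewrite big_cons DE !Rintegral_setU //; do ?[by apply: iS => //; rewrite -DE].
rewrite opprD addrACA; apply: (le_trans (ler_normD _ _)).
apply: lerD; last exact: hs.
have -> : (fine (m A), k).1 * f (fine (m A), k).2 = \int[m]_(x in A) (f k).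
  by rewrite /= Rintegral_cst // mulrC.
rewrite -RintegralB //; [|exact: iS|exact: iS].
have cfk : {within K, continuous (fun x => f x - f k)} by exact: within_sub.
apply: (le_trans (le_normr_Rintegral mA (iS _ _ AK mA cfk))).
apply: le_Rintegral => //.
- by apply: integrable_norm; exact: iS.
- exact: iS.
by move=> x [Dx /interior_subset Ex]; rewrite distrC; apply: fe => //; exact: DK.
Qed.

End haar_positivity.

(** * Parameter integrals and interchange of integrals *)

Section haar_param.
Variables (R : realType) (G : lcGroupType) (K K' : compact_subgroup G).
Variables (m : haar_measure R K) (m' : haar_measure R K').
Variable h : G -> G -> R.
Hypothesis ch : {within K `*` K', continuous (fun p => h p.1 p.2)}.

(** [compact_tube] bounds the variation of the integrand uniformly in [y], and [m'] has mass one on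
    [K']. The bound [e / 2] makes the final inequality strict. *)
Lemma haar_param_continuous :
  {within K, continuous (fun x => \int[m']_(y in K') h x y)}.
Proof.
apply: near_within => x e Kx e0.
have e20 : 0 < e / 2 by rewrite divr_gt0.
apply: filterS (compact_tube (@carrier_compact G K') ch Kx e20).
move=> x' hx' Kx'.
have [cx cx'] := (within_slice_r ch Kx, within_slice_r ch Kx').
rewrite -haar_sub //; apply: (@le_lt_trans _ _ (e / 2)).
  apply: haar_norm_le; first exact: within_sub.
  by move=> y Ky; apply/ltW/hx'.
by rewrite ltr_pdivrMr // ltr_pMr // ltr1n.
Qed.

End haar_param.

(* The product of the Borel algebras of two non-metrisable groups may be
   smaller than the Borel algebra of their product, so that the Fubini theorem
   for product measures does not apply; continuous integrands are handled by
   approximating one of the integrals by finite sums. *)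
Lemma haar_fubini (R : realType) (G : lcGroupType) (K K' : compact_subgroup G)
    (m : haar_measure R K) (m' : haar_measure R K') (h : G -> G -> R) :
  {within K `*` K', continuous (fun p => h p.1 p.2)} ->
  \int[m]_(x in K) \int[m']_(y in K') h x y =
  \int[m']_(y in K') \int[m]_(x in K) h x y.
Proof.
move=> ch; apply/eqP; rewrite -subr_eq0 -normr_le0.
apply/ler_addgt0Pr => e2 e20; rewrite add0r.
pose e := e2 / 2; have e0 : 0 < e by rewrite divr_gt0.
(* Closeness is demanded for all [y] at once, so one set of nodes serves every slice [h^~ y] and
   also the inner integral as a function of [x]. *)
pose E x := [set x' | carrier K x' ->
  forall y, carrier K' y -> `|h x y - h x' y| < e].
have [|s sK hs] := @haar_quadrature R G K m E e.
  by move=> x Kx; exact: compact_tube (@carrier_compact G K') ch Kx e0.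
have cs p : p \in s -> {within K', continuous (fun y => p.1 * h p.2 y)}.
  move=> ps; apply: within_mul; first exact: within_cst.
  exact: (within_slice_r ch (sK p ps)).
have cS := within_sum cs.
have cF := haar_param_continuous (m' := m') ch.
have cF' := haar_param_continuous (m' := m) (h := fun y x => h x y)
  (within_swap (h := h) ch).
(* [S] is the quadrature sum for the left-hand side and, by linearity, the integral over [y] of the
   quadrature sums of the slices; each side is thus within [e] of it. *)
pose S := \sum_(p <- s) p.1 * \int[m']_(y in K') h p.2 y.
have SE : S = \int[m']_(y in K') \sum_(p <- s) p.1 * h p.2 y.
  rewrite haar_sum //; apply: eq_big_seq => p ps; rewrite haar_scale //.
  exact: (within_slice_r ch (sK p ps)).
rewrite [e2]splitr; apply: (le_trans (ler_distD S _ _)); apply: lerD.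
  apply: (hs (fun x => \int[m']_(y in K') h x y)) => // x x' Kx Kx' Ex.
  have [cx cx'] := (within_slice_r ch Kx, within_slice_r ch Kx').
  rewrite -haar_sub //; apply: haar_norm_le; first exact: within_sub.
  by move=> y K'y; apply/ltW/Ex.
rewrite distrC SE -haar_sub //; apply: haar_norm_le; first exact: within_sub.
move=> y K'y; apply: (hs (h^~ y)); first exact: (within_slice_l ch K'y).
by move=> x x' Kx Kx' Ex; apply/ltW/Ex.
Qed.

(** * Inversion, right invariance and integration over a product group *)

Section haar_unimodular.
Variables (R : realType) (G : lcGroupType) (K : compact_subgroup G).
Variable m : haar_measure R K.
Implicit Type f : G -> R.

(** The double integral of [f (y^-1 * x)] is computed in both orders: left invariance in [y] leaves
    the integral of [f (y^-1)], left invariance in [x] leaves that of [f]. *)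
Lemma haar_inv f : {within K, continuous f} ->
  \int[m]_(x in K) f (x^-1)%g = \int[m]_(x in K) f x.
Proof.
move=> cf.
have ch : {within K `*` K, continuous (fun p => f (p.2^-1 * p.1)%g)}.
  apply: within_comp cf => [|p [/= K1 K2]].
    apply: mulg_continuous_comp; last exact: fst_continuous.
    by apply: invg_continuous_comp; exact: snd_continuous.
  by apply: carrierM => //; exact: carrierV.
have := haar_fubini (h := fun x y => f (y^-1 * x)%g) m m ch.
have -> : \int[m]_(x in K) \int[m]_(y in K) f (y^-1 * x)%g =
    \int[m]_(x in K) \int[m]_(y in K) f (y^-1)%g.
  apply: haar_ext => x Kx.
  have cx := within_slice_r (h := fun x y => f (y^-1 * x)%g) ch Kx.
  rewrite -(haar_lmul m cx Kx).
  by apply: haar_ext => y Ky; rewrite invgM -mulgA mulVg mulg1.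
rewrite haar_cst => ->; rewrite -[RHS](haar_cst m); apply: haar_ext => y Ky.
by rewrite haar_lmul //; exact: carrierV.
Qed.

Lemma haar_rmul f (k : G) : {within K, continuous f} -> carrier K k ->
  \int[m]_(x in K) f (x * k)%g = \int[m]_(x in K) f x.
Proof.
move=> cf Kk.
have cV : {within K, continuous (fun x => f (x^-1)%g)}.
  by apply: within_comp cf; [exact: invg_continuous|exact: carrierV].
have cR : {within K, continuous (fun x => f (x * k)%g)}.
  apply: within_comp cf => [|x Kx]; last exact: carrierM.
  by apply: mulg_continuous_comp => x; [exact: cvg_id|exact: cvg_cst].
rewrite -(haar_inv cR) -(haar_inv cf) -(haar_lmul m cV (carrierV Kk)).
by apply: haar_ext => x _; rewrite invgM invgK.
Qed.

End haar_unimodular.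

(** Two-sided invariance under [L] allows [f z] to be averaged to the integral of [f (x * z * y)]
    over [K1] and [K2]. Writing [z = a * b], right invariance of [m1] absorbs [a] and left
    invariance of [m2] absorbs [b], so the average does not depend on [z]. *)
Lemma haar_setmulg (R : realType) (G : lcGroupType)
    (K1 K2 L : compact_subgroup G) (m1 : haar_measure R K1)
    (m2 : haar_measure R K2) (m : haar_measure R L) (f : G -> R) :
  (L : set G) = setmulg K1 K2 -> {within L, continuous f} ->
  \int[m]_(z in L) f z =
  \int[m1]_(x in K1) \int[m2]_(y in K2) f (x * y)%g.
Proof.
move=> LE cf.
have K1L x : carrier K1 x -> carrier L x.
  by move=> Kx; rewrite LE; exists x => //; exists 1%g; rewrite ?mulg1 //;
    exact: carrier1.
have K2L x : carrier K2 x -> carrier L x.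
  by move=> Kx; rewrite LE; exists 1%g; [exact: carrier1|exists x;
    rewrite ?mul1g].
pose P z := \int[m2]_(y in K2) f (z * y)%g.
have c2 : {within L `*` K2, continuous (fun p => f (p.1 * p.2)%g)}.
  apply: within_comp cf => [|p [/= p1 p2]]; first exact: mulg_continuous.
  by apply: carrierM => //; exact: K2L.
have cP : {within L, continuous P}
    := (haar_param_continuous (h := fun z y => f (z * y)%g) c2).
have c1 : {within L `*` K1, continuous (fun p => P (p.2 * p.1)%g)}.
  apply: within_comp cP => [|p [/= p1 p2]].
    by apply: mulg_continuous_comp; [exact: snd_continuous|
      exact: fst_continuous].
  by apply: carrierM => //; exact: K1L.
have -> : \int[m]_(z in L) f z = \int[m]_(z in L) P z.
  rewrite (haar_fubini (h := fun z y => f (z * y)%g) m m2) //.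
  rewrite -[LHS](haar_cst m2); apply: haar_ext => y Ky.
  by rewrite haar_rmul //; exact: K2L.
have -> : \int[m]_(z in L) P z =
    \int[m]_(z in L) \int[m1]_(x in K1) P (x * z)%g.
  rewrite (haar_fubini (h := fun z x => P (x * z)%g) m m1) //.
  rewrite -[LHS](haar_cst m1).
  by apply: haar_ext => x Kx; rewrite haar_lmul //; exact: K1L.
rewrite -[RHS](haar_cst m); apply: haar_ext => z; rewrite LE.
move=> [a K1a [b K2b <-]].
have cPr : {within K1, continuous P}.
  by apply: within_comp cP => // x; exact: cvg_id.
transitivity (\int[m1]_(x in K1) P (x * a)%g); last exact: haar_rmul.
apply: haar_ext => x K1x; rewrite /P.
rewrite -[RHS](haar_lmul m2 _ K2b).
  by apply: haar_ext => y _; rewrite !mulgA.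
apply: (within_slice_r (h := fun z y => f (z * y)%g) c2).
by apply: carrierM; exact: K1L.
Qed.

(** * Complex-valued Haar integrals *)

Section complex_integral.
Variables (R : realType) (G : lcGroupType) (K : compact_subgroup G).
Variable m : haar_measure R K.
Implicit Type f : G -> R[i].

Lemma Im_continuous : continuous (fun z : R[i]^o => complex.Im z).
Proof.
move=> z; rewrite (_ : (fun=> _) = fun z : R[i]^o => complex.Re (- 'i%C * z)).
  apply: (@continuous_comp _ _ _ (fun z : R[i]^o => - 'i%C * z : R[i]^o)).
    exact: mulrl_continuous.
  exact: Re_continuous.
by apply/funext => w; rewrite Im_Re.
Qed.

Lemma within_complex_Re (T : topologicalType) (A : set T) (f : T -> R[i]) :
  {within A, continuous (f : T -> R[i]^o)} ->
  {within A, continuous (fun x => complex.Re (f x))}.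
Proof. by move=> cf; apply: within_comp_continuous cf; exact: Re_continuous. Qed.

Lemma within_complex_Im (T : topologicalType) (A : set T) (f : T -> R[i]) :
  {within A, continuous (f : T -> R[i]^o)} ->
  {within A, continuous (fun x => complex.Im (f x))}.
Proof. by move=> cf; apply: within_comp_continuous cf; exact: Im_continuous. Qed.

Lemma within_cmul (T : topologicalType) (A : set T) (f g : T -> R[i]) :
  {within A, continuous (f : T -> R[i]^o)} ->
  {within A, continuous (g : T -> R[i]^o)} ->
  {within A, continuous ((fun x => f x * g x) : T -> R[i]^o)}.
Proof.
by move=> cf cg x; apply: (@cvgM _ _ (nbhs (x : subspace A)));
  [exact: cf|exact: cg].
Qed.

Lemma cintegral_ext f g : (forall x, carrier K x -> f x = g x) ->
  cintegral m K f = cintegral m K g.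
Proof. by move=> fg; congr (_ +i* _); apply: haar_ext => x Kx; rewrite fg. Qed.

Lemma cintegral0 : cintegral m K (fun=> 0) = 0.
Proof. by rewrite /cintegral /= !haar_cst. Qed.

Lemma cintegral_scale f (c : R[i]) :
  {within K, continuous (f : G -> R[i]^o)} ->
  cintegral m K (fun x => c * f x) = c * cintegral m K f.
Proof.
move=> cf; have [cR cI] := (within_complex_Re cf, within_complex_Im cf).
have cZ (r : R) (g : G -> R) : {within K, continuous g} ->
    {within K, continuous (fun x => r * g x)}.
  by move=> cg; apply: within_mul => //; exact: within_cst.
case: c => a b; rewrite /cintegral; congr (_ +i* _) => /=.
  rewrite -!(haar_scale m) // -haar_sub; [|exact: cZ..].
  by apply: haar_ext => x _; case: (f x).
rewrite -!(haar_scale m) // -haar_add; [|exact: cZ..].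
by apply: haar_ext => x _; case: (f x).
Qed.

Lemma cintegral_lmul f (k : G) : {within K, continuous (f : G -> R[i]^o)} ->
  carrier K k -> cintegral m K (fun x => f (k * x)%g) = cintegral m K f.
Proof.
move=> cf Kk; congr (_ +i* _).
  exact: (haar_lmul m (within_complex_Re cf) Kk).
exact: (haar_lmul m (within_complex_Im cf) Kk).
Qed.

Lemma cintegral_rmul f (k : G) : {within K, continuous (f : G -> R[i]^o)} ->
  carrier K k -> cintegral m K (fun x => f (x * k)%g) = cintegral m K f.
Proof.
move=> cf Kk; congr (_ +i* _).
  exact: (haar_rmul m (within_complex_Re cf) Kk).
exact: (haar_rmul m (within_complex_Im cf) Kk).
Qed.

End complex_integral.

(** * Characters and their behaviour under translation *)

Section character_theory.
Variables (R : realType) (G : lcGroupType) (K : compact_subgroup G).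
Variables (m : haar_measure R K) (rho : character R K).

Lemma character_neq0 k : carrier K k -> rho k != 0.
Proof. by move=> Kk; rewrite -normr_eq0 character_norm1 // oner_eq0. Qed.

Lemma character1 : rho 1%g = 1.
Proof.
have K1 := carrier1 K; apply: (mulfI (character_neq0 K1)).
by rewrite mulr1 -characterM // mulg1.
Qed.

Lemma character_measure_ltrans (k : G) (u : C0 R G) : carrier K k ->
  character_measure m rho (ltrans k u) =
  (rho k)^-1 * character_measure m rho u.
Proof.
move=> Kk; rewrite !character_measureE.
have cu := @character_continuous_mul R G K rho u.
have ck := @character_continuous_mul R G K rho (ltrans k u).
apply: (mulfI (character_neq0 Kk)).
rewrite mulrA divff ?character_neq0 // mul1r -cintegral_scale //.
rewrite -(cintegral_lmul m cu Kk); apply: cintegral_ext => x Kx.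
by rewrite characterM // mulrCA.
Qed.

End character_theory.

Section translation.
Variables (R : realType) (G : lcGroupType).
Implicit Types (mu nu : measure_alg R G) (u : C0 R G).

Lemma ltransM (x y : G) u : ltrans y (ltrans x u) = ltrans (x * y)%g u.
Proof. by apply: C0_ext => z; rewrite /= /ltrans /C0_fun /= mulgA. Qed.

Lemma slice_ltrans nu (k : G) u : slice nu (ltrans k u) = ltrans k (slice nu u).
Proof.
by apply: C0_ext => x; rewrite -[LHS]/(nu (ltrans x (ltrans k u))) ltransM.
Qed.

End translation.

(** * Convolution of two character measures *)

Section convolution_of_characters.
Variables (R : realType) (G : lcGroupType) (K1 K2 : compact_subgroup G).
Variables (m1 : haar_measure R K1) (m2 : haar_measure R K2).
Variables (rho1 : character R K1) (rho2 : character R K2).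
Implicit Type u : C0 R G.

Let mu1 := character_measure m1 rho1.
Let mu2 := character_measure m2 rho2.

(** [slice] commutes with left translation, so only the left factor of the convolution is affected
    by [k]. *)
Lemma convolution_ltrans (k : G) u : carrier K1 k ->
  convolution mu1 mu2 (ltrans k u) = (rho1 k)^-1 * convolution mu1 mu2 u.
Proof.
by move=> Kk; rewrite !convolutionE slice_ltrans character_measure_ltrans.
Qed.

Lemma convolution_charactersE u : convolution mu1 mu2 u =
  cintegral m1 K1 (fun x =>
    cintegral m2 K2 (fun y => u (x * y)%g * (rho1 x * rho2 y))).
Proof.
rewrite convolutionE character_measureE; apply: cintegral_ext => x Kx.
rewrite -[slice _ _ _]/(mu2 (ltrans x u)) character_measureE mulrC.
rewrite -cintegral_scale; last exact: character_continuous_mul.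
by apply: cintegral_ext => y Ky; rewrite mulrCA.
Qed.

Lemma convolution_disagree (k : G) : carrier K1 k -> carrier K2 k ->
  rho1 k != rho2 k -> convolution mu1 mu2 = 0.
Proof.
move=> k1 k2 neq; apply: val_inj; apply/funext => u.
rewrite -[LHS]/(convolution mu1 mu2 u) -[RHS]/(0 : R[i]) convolutionE.
set F := slice mu2 u.
have FE x : F (x * k)%g = (rho2 k)^-1 * F x.
  by rewrite -[LHS]/(mu2 (ltrans (x * k)%g u)) -ltransM character_measure_ltrans.
have cF := @character_continuous_mul R G K1 rho1 F.
(* Right invariance of [m1] leaves [mu1 F] unchanged under [x |-> x * k], whereas [F] and [rho1]
   together pick up the factor [rho1 k / rho2 k]. *)
have : rho2 k * mu1 F = rho1 k * mu1 F.
  rewrite /mu1 character_measureE -{1}(cintegral_rmul m1 cF k1).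
  have -> : cintegral m1 K1 (fun x => F (x * k)%g * rho1 (x * k)%g) =
      (rho2 k)^-1 * rho1 k * cintegral m1 K1 (fun x => F x * rho1 x).
    rewrite -cintegral_scale //; apply: cintegral_ext => x Kx.
    by rewrite FE characterM // [rho1 x * _]mulrC mulrACA.
  by rewrite !mulrA divff ?mul1r // character_neq0.
move=> /eqP; rewrite -subr_eq0 -mulrBl mulf_eq0 subr_eq0 eq_sym (negbTE neq).
by move=> /eqP.
Qed.

Lemma convolution_product (L : compact_subgroup G) (m : haar_measure R L)
    (rho : character R L) :
  (L : set G) = setmulg K1 K2 ->
  (forall k1 k2, carrier K1 k1 -> carrier K2 k2 ->
     rho (k1 * k2)%g = rho1 k1 * rho2 k2) ->
  convolution mu1 mu2 = character_measure m rho.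
Proof.
move=> LE rhoE; apply: val_inj; apply/funext => u.
rewrite -[LHS]/(convolution mu1 mu2 u) -[RHS]/(character_measure m rho u).
rewrite convolution_charactersE character_measureE.
have cu := @character_continuous_mul R G L rho u.
(* The integrand becomes a function of [x * y] alone, so [haar_setmulg] applies to its real and
   imaginary parts. *)
transitivity (cintegral m1 K1 (fun x => cintegral m2 K2 (fun y =>
    u (x * y)%g * rho (x * y)%g))).
  apply: cintegral_ext => x K1x; apply: cintegral_ext => y K2y.
  by rewrite rhoE.
congr (_ +i* _); apply/esym.
  exact: (haar_setmulg m1 m2 m LE (within_complex_Re cu)).
exact: (haar_setmulg m1 m2 m LE (within_complex_Im cu)).
Qed.

End convolution_of_characters.

(** * Bump functions and the support of the convolution *)

Lemma C0_bump (R : realType) (G : lcGroupType) (z : G) (U : set G) :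
  nbhs z U -> exists v : G -> R, [/\ continuous v, forall x, 0 <= v x, v z = 1,
    forall x, ~ U x -> v x = 0 & vanishes_at_infinity (fun x => (v x)%:C)].
Proof.
move=> Uz; have [C] := @group_locally_compact G z I.
rewrite withinET => Cz [cC _].
have UCz : nbhs z (U `&` C) by exact: filterI.
pose B := ~` interior (U `&` C).
have clB : closed B by apply: open_closedC; exact: open_interior.
have nBz : ~ B z by move=> Bz; apply: Bz.
(* The separating function [f] is 0 at [z] and 1 on [B]; hence [1 - f] is the bump, and it vanishes
   at infinity because it is zero outside the compact set [C]. *)
have /(@uniform_separatorP G R) [f [cf f01 fz fB]] :=
  @locally_compact_completely_regular G R (@group_locally_compact G)
    (@group_hausdorff G) z B clB nBz.
have vB x : ~ (U `&` C) x -> 1 - f x = 0.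
  move=> nUC; apply/eqP; rewrite subr_eq0 eq_sym; apply/eqP; apply: fB.
  by exists x => // /interior_subset.
exists (fun x => 1 - f x); split.
- by move=> x; apply: cvgB; [exact: cvg_cst|exact: cf].
- move=> x; rewrite subr_ge0.
  by have /= := f01 (f x) (imageT f x); rewrite in_itv => /andP[].
- by have /= -> := fz (f z) (imageP f erefl); rewrite subr0.
- by move=> x nU; apply: vB => -[].
- move=> e e0; exists C => // x nC.
  by rewrite vB ?normr0 // => -[].
Qed.

Lemma setmulg_compact (G : lcGroupType) (A B : set G) :
  compact A -> compact B -> compact (setmulg A B).
Proof.
move=> cA cB; rewrite (_ : setmulg A B =
    (fun p : G * G => p.1 * p.2)%g @` (A `*` B)).
  apply: continuous_compact; last exact: compact_setX.
  by apply: continuous_subspaceT; exact: mulg_continuous.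
apply/seteqP; split=> [_ [x Ax [y By <-]]|_ [[x y] [/= Ax By] <-]].
  by exists (x, y).
by exists x => //; exists y.
Qed.

Section convolution_support.
Variables (R : realType) (G : lcGroupType) (K1 K2 : compact_subgroup G).
Variables (m1 : haar_measure R K1) (m2 : haar_measure R K2).
Variables (rho1 : character R K1) (rho2 : character R K2).

Lemma characters_mul_continuous (c : R[i]) : {within K1 `*` K2, continuous
  ((fun p : G * G => c * (rho1 p.1 * rho2 p.2)) : G * G -> R[i]^o)}.
Proof.
apply: within_cmul; first by apply: continuous_subspaceT => p; exact: cvg_cst.
apply: within_cmul.
  apply: (@within_comp _ _ _ K1 _ (rho1 : G -> R[i]^o)) => [|p []//|].
    exact: fst_continuous.
  exact: character_continuous.
apply: (@within_comp _ _ _ K2 _ (rho2 : G -> R[i]^o)) => [|p []//|].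
  exact: snd_continuous.
exact: character_continuous.
Qed.

Hypothesis agree : forall k, carrier K1 k -> carrier K2 k -> rho1 k = rho2 k.

(** Two factorisations of the same element differ by [k = a^-1 * x = b * y^-1], which lies in both
    subgroups, and there the characters agree. *)
Lemma agree_mul (a b x y : G) : carrier K1 a -> carrier K2 b ->
  carrier K1 x -> carrier K2 y -> (x * y = a * b)%g ->
  rho1 x * rho2 y = rho1 a * rho2 b.
Proof.
move=> K1a K2b K1x K2y xyab.
have [k [K1k K2k -> ->]] : exists k,
    [/\ carrier K1 k, carrier K2 k, x = (a * k)%g & b = (k * y)%g].
  have kE : (a^-1 * x = b * y^-1)%g.
    by rewrite -[x in LHS](mulgK y) xyab !mulgA mulVg mul1g.
  exists (a^-1 * x)%g; split; last by rewrite kE mulgVK.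
  - by apply: carrierM => //; exact: carrierV.
  - by rewrite kE; apply: carrierM => //; exact: carrierV.
  - by rewrite mulVKg.
by rewrite !characterM // (agree K1k K2k) mulrA.
Qed.

(* On the fibre [x * y = a * b] the integrand [rho1 x * rho2 y] is constant, so
   on nearby fibres its argument is almost constant and no cancellation can
   occur. *)
Lemma convolution_support (a b : G) (U : set G) :
  carrier K1 a -> carrier K2 b -> nbhs (a * b)%g U ->
  exists2 u : C0 R G, (forall x, ~ U x -> u x = 0) &
    convolution (character_measure m1 rho1) (character_measure m2 rho2) u != 0.
Proof.
(* The constant [c] normalises [w] to 1 on the fibre over [a * b]. *)
move=> K1a K2b Uab; pose c := (rho1 a * rho2 b)^-1.
have c0 : rho1 a * rho2 b != 0 by rewrite mulf_neq0 // character_neq0.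
pose w (x y : G) : R := complex.Re (c * (rho1 x * rho2 y)).
have cw : {within K1 `*` K2, continuous (fun p : G * G => w p.1 p.2)}.
  exact: (within_complex_Re (characters_mul_continuous (c := c))).
(* For [z] close to [a * b], [w] is positive on the whole fibre over [z]. Near pairs of the fibre
   over [a * b] this is continuity of [w]; near other pairs, the Hausdorff property keeps the
   product away from [z]. *)
have near_z : \forall z \near (a * b)%g, K1 `*` K2 `<=`
    [set p : G * G | (K1 `*` K2) p -> (p.1 * p.2)%g = z -> 0 < w p.1 p.2].
  apply: (@compact_near_coveringP _ (K1 `*` K2)).1.
    by apply: compact_setX; exact: carrier_compact.
  move=> -[x y] /= K12.
  have [xyab|/eqP xyab] := pselect (x * y = a * b)%g.
    have wxy : w x y = 1.
      case: K12 => K1x K2y.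
      by rewrite /w (agree_mul K1a K2b K1x K2y xyab) mulVf.
    have near_xy := within_near (x := (x, y)) cw K12 ltr01.
    exists ([set p | (K1 `*` K2) p -> `|w x y - w p.1 p.2| < 1], setT).
      by split=> //=; exact: filterT.
    move=> -[p z] /= [h _] K12p _; have := h K12p.
    by rewrite wxy => /(le_lt_trans (ler_norm _)); rewrite ltrBlDl ltrDr.
  have := @group_hausdorff G; rewrite open_hausdorff => /(_ _ _ xyab).
  move=> [[A B] /= [/set_mem Axy /set_mem Bab] [oA oB /eqP AB0]].
  have near_xy : \forall p \near (x, y), A (p.1 * p.2)%g.
    by apply: (@mulg_continuous G (x, y)); exact: open_nbhs_nbhs.
  have near_ab : \forall z \near (a * b)%g, B z by exact: open_nbhs_nbhs.
  exists (([set p | A (p.1 * p.2)%g], B)) => //= -[p z] /= [Ap Bz] _ pz.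
  have : (A `&` B) z by split=> //; rewrite -pz.
  by rewrite AB0.
have [v [cv v0 vab vU vinf]] := C0_bump R (filterI Uab near_z).
have cvC : continuous ((fun x => (v x)%:C) : G -> R[i]^o).
  move=> x; apply: (@continuous_comp _ _ _ v (fun r : R => r%:C : R[i]^o)).
    exact: cv.
  exact: ofreal_continuous.
pose u : C0 R G := mkC0 (conj cvC vinf).
exists u.
  move=> x nUx; rewrite /u /C0_fun /= vU // => -[Ux _]; exact: nUx.
(* The bump lives where [w] is positive on fibres, so the integrand [g] is nonnegative, and
   [g a b = 1]; [haar_gt0] is then applied in each variable. *)
suff : 0 < complex.Re (c * convolution (character_measure m1 rho1)
    (character_measure m2 rho2) u).
  by apply: contraTneq => ->; rewrite mulr0 ltxx.
pose g x y := v (x * y)%g * w x y.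
have cg : {within K1 `*` K2, continuous (fun p : G * G => g p.1 p.2)}.
  apply: within_mul => //; apply: continuous_subspaceT => p.
  apply: (@continuous_comp _ _ _ (fun p : G * G => p.1 * p.2)%g v).
    exact: mulg_continuous.
  exact: cv.
have g0 x y : carrier K1 x -> carrier K2 y -> 0 <= g x y.
  move=> K1x K2y; rewrite /g.
  have [[_ h]|h] := pselect ((U `&` [set z | K1 `*` K2 `<=` [set p : G * G |
      (K1 `*` K2) p -> (p.1 * p.2)%g = z -> 0 < w p.1 p.2]]) (x * y)%g).
    by apply: mulr_ge0 => //; apply/ltW/(h (x, y)).
  by rewrite vU // mul0r.
have -> : complex.Re (c * convolution (character_measure m1 rho1)
    (character_measure m2 rho2) u) =
    \int[m1]_(x in K1) \int[m2]_(y in K2) g x y.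
  have -> : c * convolution (character_measure m1 rho1)
      (character_measure m2 rho2) u =
      cintegral m1 K1 (fun x => c * rho1 x * slice (character_measure m2 rho2) u x).
    rewrite convolutionE character_measureE -cintegral_scale.
      by apply: cintegral_ext => x _; rewrite [_ * rho1 x]mulrC mulrA.
    exact: character_continuous_mul.
  apply: haar_ext => x K1x.
  rewrite -[slice _ _ _]/(character_measure m2 rho2 (ltrans x u)).
  rewrite character_measureE -cintegral_scale.
    apply: haar_ext => y _; rewrite /g /w.
    rewrite -[ltrans x u y]/((v (x * y)%g)%:C) mulrCA -mulrA.
    rewrite -[c * (rho1 x * rho2 y)]mul1r.
    by case: (c * (rho1 x * rho2 y)) => p q /=; rewrite !mul0r !subr0 !mul1r.
  exact: character_continuous_mul.
apply: (@haar_gt0 _ _ _ m1 _ a) => //.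
- exact: (haar_param_continuous cg).
- by move=> x K1x; apply: Rintegral_ge0 => y K2y; exact: g0.
apply: (@haar_gt0 _ _ _ m2 _ b) => //.
- exact: (within_slice_r cg K1a).
- by move=> y K2y; exact: g0.
by rewrite /g vab mul1r /w mulVf //= ltr01.
Qed.

(** If [a * b] were outside the closed set [K2 K1], some function vanishing on [K2 K1] would have a
    nonzero integral against [mu1 * mu2], while its integral against [mu2 * mu1] is zero. *)
Lemma commute_setmulg_sub :
  convolution (character_measure m1 rho1) (character_measure m2 rho2) =
  convolution (character_measure m2 rho2) (character_measure m1 rho1) ->
  setmulg K1 K2 `<=` setmulg K2 K1.
Proof.
move=> comm _ [a K1a [b K2b <-]]; apply: contrapT => nab.
have cK : compact (setmulg K2 K1).
  by apply: setmulg_compact; exact: carrier_compact.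
have oU : open (~` setmulg K2 K1).
  by apply: closed_openC; exact: compact_closed (@group_hausdorff G) cK.
have [|u uU] := @convolution_support a b (~` setmulg K2 K1) K1a K2b.
  exact: open_nbhs_nbhs.
rewrite comm convolution_charactersE (cintegral_ext _ (g := fun=> 0)).
  by rewrite cintegral0 eqxx.
move=> x K2x; rewrite (cintegral_ext _ (g := fun=> 0)) ?cintegral0 //.
by move=> y K1y; rewrite uU ?mul0r //; apply; exists x => //; exists y.
Qed.

Lemma commute_compact_subgroup :
  convolution (character_measure m1 rho1) (character_measure m2 rho2) =
  convolution (character_measure m2 rho2) (character_measure m1 rho1) ->
  is_compact_subgroup (setmulg K1 K2).
Proof.
move=> /commute_setmulg_sub sub.
have sub' : setmulg K2 K1 `<=` setmulg K1 K2.
  move=> _ [b K2b [a K1a <-]].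
  (* The inverse of [b * a] lies in [K1 K2], hence in [K2 K1]; inverting again gives the opposite
     inclusion. *)
  have [|b' K2b' [a' K1a' ba]] := sub (a^-1 * b^-1)%g.
    by exists (a^-1)%g; [exact: carrierV|exists (b^-1)%g; [exact: carrierV|]].
  exists (a'^-1)%g; first exact: carrierV.
  by exists (b'^-1)%g; [exact: carrierV|rewrite -invgM ba -invgM invgK].
split.
- by apply: setmulg_compact; exact: carrier_compact.
- by exists 1%g; [exact: carrier1|exists 1%g; [exact: carrier1|rewrite mulg1]].
- move=> _ _ [a K1a [b K2b <-]] [a' K1a' [b' K2b' <-]].
  have [|x K1x [y K2y xy]] := sub' (b * a')%g.
    by exists b => //; exists a'.
  exists (a * x)%g; first exact: carrierM.
  exists (y * b')%g; first exact: carrierM.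
  by rewrite -!mulgA [(x * _)%g]mulgA xy !mulgA.
- move=> _ [a K1a [b K2b <-]]; apply: sub'; rewrite invgM.
  by exists (b^-1)%g; [exact: carrierV|exists (a^-1)%g; [exact: carrierV|]].
Qed.

End convolution_support.

(** * The character of the product group *)

Section product_character.
Variables (R : realType) (G : lcGroupType) (K1 K2 L : compact_subgroup G).
Variables (m1 : haar_measure R K1) (m2 : haar_measure R K2).
Variables (rho1 : character R K1) (rho2 : character R K2).
Hypothesis LE : (L : set G) = setmulg K1 K2.

Lemma product_carrier_l k : carrier K1 k -> carrier L k.
Proof.
by move=> Kk; rewrite LE; exists k => //; exists 1%g; rewrite ?mulg1 //;
  exact: carrier1.
Qed.

Lemma product_carrier_r k : carrier K2 k -> carrier L k.
Proof.
by move=> Kk; rewrite LE; exists 1%g; [exact: carrier1|exists k;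
  rewrite ?mul1g].
Qed.

Lemma product_carrierC : (L : set G) = setmulg K2 K1.
Proof.
apply/seteqP; split=> [z Lz|_ [b K2b [a K1a <-]]]; last first.
  by apply: carrierM; [exact: product_carrier_r|exact: product_carrier_l].
have := carrierV Lz; rewrite LE => -[a K1a [b K2b abz]].
exists (b^-1)%g; first exact: carrierV.
by exists (a^-1)%g; [exact: carrierV|rewrite -invgM abz invgK].
Qed.

Lemma product_characterC (rho : character R L) :
  (forall k1 k2, carrier K1 k1 -> carrier K2 k2 ->
     rho (k1 * k2)%g = rho1 k1 * rho2 k2) ->
  forall k2 k1, carrier K2 k2 -> carrier K1 k1 ->
     rho (k2 * k1)%g = rho2 k2 * rho1 k1.
Proof.
move=> rhoE b a K2b K1a.
rewrite characterM; [|exact: product_carrier_r|exact: product_carrier_l].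
rewrite -[a in LHS]mulg1 -[b in LHS]mul1g !rhoE ?character1 ?mul1r ?mulr1 //.
  exact: carrier1.
exact: carrier1.
Qed.

Let mu1 := character_measure m1 rho1.
Let mu2 := character_measure m2 rho2.
Hypothesis agree : forall k, carrier K1 k -> carrier K2 k -> rho1 k = rho2 k.
Hypothesis comm : convolution mu1 mu2 = convolution mu2 mu1.

(* Translating [mu1 * mu2 = mu2 * mu1] by an element of [K1] or [K2] scales it,
   so translating it by [l] in [L] scales it by a factor [(rho l)^-1], which is
   read off any [u] with [(mu1 * mu2) u != 0]. *)
Lemma commute_character : exists rho : character R L,
  forall k1 k2, carrier K1 k1 -> carrier K2 k2 ->
    rho (k1 * k2)%g = rho1 k1 * rho2 k2.
Proof.
set mu := convolution mu1 mu2.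
have mul1 k u : carrier K1 k -> mu (ltrans k u) = (rho1 k)^-1 * mu u.
  exact: convolution_ltrans.
have mul2 k u : carrier K2 k -> mu (ltrans k u) = (rho2 k)^-1 * mu u.
  by rewrite /mu comm; exact: convolution_ltrans.
have [u _ u0] : exists2 u : C0 R G, (forall x, ~ [set: G] x -> u x = 0) &
    mu u != 0.
  apply: (convolution_support m1 m2 agree (carrier1 K1) (carrier1 K2)).
  exact: filterT.
(* From here on, only the two scaling laws and [mu u != 0] are needed, so [mu] is generalised to an
   arbitrary element of the measure algebra. *)
move: mul1 mul2 u0; move: mu => mu mul1 mul2 u0.
have mul12 a b v : carrier K1 a -> carrier K2 b ->
    mu (ltrans (a * b)%g v) = (rho1 a * rho2 b)^-1 * mu v.
  move=> K1a K2b; rewrite -ltransM mul2 // mul1 //.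
  by rewrite invfM mulrCA mulrA.
pose r l : R[i] := mu u / slice mu u l.
have rE a b : carrier K1 a -> carrier K2 b -> r (a * b)%g = rho1 a * rho2 b.
  move=> K1a K2b; rewrite /r -[slice mu u _]/(mu (ltrans (a * b)%g u)) mul12 //.
  by rewrite invfM invrK mulrCA divff // mulr1.
have r0 l : carrier L l -> r l != 0.
  rewrite LE => -[a K1a [b K2b <-]].
  by rewrite rE // mulf_neq0 // character_neq0.
have mur l v : carrier L l -> mu (ltrans l v) = (r l)^-1 * mu v.
  by rewrite LE => -[a K1a [b K2b <-]]; rewrite mul12 // rE.
(* Up to a constant, [r] is the inverse of [slice mu u], a continuous function that has no zeros on
   [L]. *)
have cr : {within L, continuous (r : G -> R[i]^o)}.
  apply/subspace_continuousP => l Ll; apply: cvgM; first exact: cvg_cst.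
  have s0 : slice mu u l != 0.
    by have := r0 l Ll; rewrite /r mulf_eq0 invr_eq0 negb_or => /andP[].
  apply: (@cvgV R[i] _ (within L (nbhs l)) _ _ _ s0).
  apply: cvg_within_filter; exact: C0_continuous.
move: rE r0 mur cr; move: r => r rE r0 mur cr.
(* Translating [u] by [x * y] at once or in two stages gives the same value of [mu], and [mu u]
   cancels. *)
have rM x y : carrier L x -> carrier L y -> r (x * y)%g = r x * r y.
  move=> Lx Ly; apply: invr_inj; apply: (mulIf u0).
  rewrite -mur; last exact: carrierM.
  by rewrite -ltransM (mur _ _ Ly) (mur _ _ Lx) invfM mulrCA mulrA.
have r1 x : carrier L x -> `|r x| = 1.
  rewrite LE => -[a K1a [b K2b <-]].
  by rewrite rE // normrM !character_norm1 // mulr1.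
by exists (Character cr rM r1).
Qed.

End product_character.



(** * The commutation criterion *)

Theorem theorem1p2 (R : realType) (G : lcGroupType)
  (m : forall K : compact_subgroup G, haar_measure R K)
  (K1 K2 : compact_subgroup G)
  (rho1 : character R K1) (rho2 : character R K2) :
  let mu1 := character_measure (m K1) rho1 in
  let mu2 := character_measure (m K2) rho2 in
  let agree := forall k : G, ((K1 : set G) `&` K2) k -> rho1 k = rho2 k in
  let product_character (L : compact_subgroup G) (rho : character R L) :=
    (L : set G) = setmulg K1 K2 /\
    forall k1 k2 : G, carrier K1 k1 -> carrier K2 k2 ->
      rho (k1 * k2)%g = rho1 k1 * rho2 k2 in
  [/\ convolution mu1 mu2 = convolution mu2 mu1 <->
        (~ agree \/
         (agree /\ exists (L : compact_subgroup G) (rho : character R L),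
                     product_character L rho)),
      ~ agree -> convolution mu1 mu2 = 0,
      agree -> forall (L : compact_subgroup G) (rho : character R L),
        product_character L rho ->
        convolution mu1 mu2 = character_measure (m L) rho,
      convolution (haar_element (m K1)) (haar_element (m K2)) =
        convolution (haar_element (m K2)) (haar_element (m K1)) <->
        is_compact_subgroup (setmulg K1 K2)
    & forall L : compact_subgroup G, (L : set G) = setmulg K1 K2 ->
        convolution (haar_element (m K1)) (haar_element (m K2)) =
        haar_element (m L)].
Proof.
move=> mu1 mu2 agree product_character.
have disagree : ~ agree ->
    convolution mu1 mu2 = 0 /\ convolution mu2 mu1 = 0.
  move=> /existsNP[k /not_implyP[[k1 k2] /eqP neq]].
  by split; apply: (@convolution_disagree _ _ _ _ _ _ _ _ k) => //;
    rewrite eq_sym.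
(* Stated for arbitrary agreeing characters, so that it covers both [rho1], [rho2] and the trivial
   characters of the last two claims. *)
have subgroup_sym (s1 : character R K1) (s2 : character R K2) :
    (forall k, carrier K1 k -> carrier K2 k -> s1 k = s2 k) ->
    convolution (character_measure (m K1) s1) (character_measure (m K2) s2) =
    convolution (character_measure (m K2) s2) (character_measure (m K1) s1) <->
    exists (L : compact_subgroup G) (rho : character R L),
      (L : set G) = setmulg K1 K2 /\
      forall k1 k2 : G, carrier K1 k1 -> carrier K2 k2 ->
        rho (k1 * k2)%g = s1 k1 * s2 k2.
  move=> s12; split=> [comm|[L [rho [LE rhoE]]]].
    pose L := CompactSubgroup (commute_compact_subgroup s12 comm).
    by have [rho rhoE] := @commute_character _ _ _ _ L _ _ _ _ erefl s12 comm;
      exists L, rho.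
  rewrite (convolution_product (m K1) (m K2) (m L) LE rhoE).
  apply/esym/convolution_product; first exact: product_carrierC LE.
  by move=> b a K2b K1a; rewrite (product_characterC LE rhoE).
have trivialE (k1 k2 : G) : carrier K1 k1 -> carrier K2 k2 -> 1 = 1 * 1 :> R[i].
  by rewrite mulr1.
split.
- split=> [comm|[/disagree[-> ->]//|[ag ex]]].
    have [ag|] := pselect agree; last by left.
    right; split=> //; apply/subgroup_sym => // k k1 k2; exact: ag.
  by apply/subgroup_sym => // k k1 k2; exact: ag.
- by move=> /disagree[].
- by move=> _ L rho [LE rhoE]; exact: convolution_product.
- split=> [/subgroup_sym|cK].
    move=> [//|L [_ [LE _]]].
    by rewrite -LE; exact: carrierP.
  (* For trivial characters, the character of the product group is again the trivial one. *)
  apply/subgroup_sym => //; exists (CompactSubgroup cK).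
  by exists (trivial_character R (CompactSubgroup cK)).
- move=> L LE; by apply: (@convolution_product _ _ K1 K2 (m K1) (m K2)
    (trivial_character R K1) (trivial_character R K2)).
Qed.
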